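(* For any state $\rho$ on $\mathcal{H}_{AB}=\mathbb{C}^{d_A}\otimes\mathbb{C}^{d_B}$, $$\mathcal{E}(\rho)\;\ge\;\sup_{H:\ \|H\|_{\mathrm{Lip}}\le1}\Bigl(\operatorname{Tr}[H\rho]-\max_{\sigma\in\mathcal{SEP}(\mathcal{H}_{AB})}\operatorname{Tr}[H\sigma]\Bigr),$$ where the supremum is over self-adjoint operators $H$ on $\mathcal{H}_{AB}$ with Lipschitz seminorm at most $1$.
   Context: Let $\mathcal{H}_A=\mathbb{C}^{d_A}$, $\mathcal{H}_B=\mathbb{C}^{d_B}$, $\mathcal{H}_{AB}=\mathcal{H}_A\otimes\mathcal{H}_B$. Write $\mathcal{D}(\mathcal{H})$ for the density operators on $\mathcal{H}$, $\mathcal{B}(\mathcal{H})$ for the operators on $\mathcal{H}$, $\|\cdot\|_{op}$ for the operator norm, and $\mathcal{SEP}(\mathcal{H}_{AB})$ for the set of separable states (convex combinations of product states $\sigma_A\otimes\sigma_B$). Fix a family $\{F_i^A\}_{i=1}^{d_A^2-1}$ of traceless Hermitian $d_A\times d_A$ matrices with $\operatorname{Tr}(F_i^AF_j^A)=\delta_{ij}$ and $\|F_i^A\|_{op}\le1$, and similarly a family $\{F_j^B\}_{j=1}^{d_B^2-1}$ for $B$. Let $\mathcal{K}_0=\{F_i^A\otimes I_B\}_i\cup\{I_A\otimes F_j^B\}_j$. On two copies $\mathcal{H}_{AB}^{(1)}\otimes\mathcal{H}_{AB}^{(2)}$ of $\mathcal{H}_{AB}$ define the cost operator $$C=\sum_{X\in\mathcal{K}_0}\bigl(X\otimes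 I_{AB}^{(2)}-I_{AB}^{(1)}\otimes X\bigr)^2 .$$ For $\rho,\sigma\in\mathcal{D}(\mathcal{H}_{AB})$ let $\Pi(\rho,\sigma)$ be the set of density operators on $\mathcal{H}_{AB}^{(1)}\otimes\mathcal{H}_{AB}^{(2)}$ with marginals $\rho$ and $\sigma$. The quantum Wasserstein distance of order 1 is $W_1(\rho,\sigma)=\bigl(\inf_{\tau\in\Pi(\rho,\sigma)}\operatorname{Tr}[C\tau]\bigr)^{1/2}$, and the Wasserstein entanglement measure is $$\mathcal{E}(\rho)=\inf_{\sigma\in\mathcal{SEP}(\mathcal{H}_{AB})}W_1(\rho,\sigma).$$ For self-adjoint $H\in\mathcal{B}(\mathcal{H}_{AB})$ the Lipschitz seminorm is $$\|H\|_{\mathrm{Lip}}=\max\Bigl\{\sup_{A\in\mathcal{B}(\mathcal{H}_A),\,\|A\|_{op}\le1}\|[A\otimes I_B,H]\|_{op},\ \sup_{B\in\mathcal{B}(\mathcal{H}_B),\,\|B\|_{op}\le1}\|[I_A\otimes B,H]\|_{op}\Bigr\}.$$ *)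

(* Defs.v *)
From mathcomp Require Import all_boot all_order all_algebra.
From mathcomp Require Import complex mxtens.
From mathcomp Require Import all_classical all_reals all_analysis.

Set Implicit Arguments.
Unset Strict Implicit.
Unset Printing Implicit Defensive.

Import Order.TTheory GRing.Theory Num.Theory.

Local Open Scope classical_set_scope.
Local Open Scope ring_scope.

(* Suprema and infima are taken in [\bar R], so that no default value is
   involved when a set is empty or unbounded. *)

Section Operators.
Context {R : realType}.
Local Notation C := R[i].

Definition adjmx m n (A : 'M[C]_(m, n)) : 'M[C]_(n, m) := map_mx Num.conj A^T.

Definition vnorm n (v : 'cV[C]_n) : R :=
  Num.sqrt (complex.Re ((adjmx v *m v) 0 0)).

Definition opnorm n (A : 'M[C]_n) : \bar R :=
  ereal_sup [set (vnorm (A *m v))%:E | v in [set v : 'cV[C]_n | vnorm v <= 1]].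

(* The order of [C] makes [0 <= z] include that [z] is real. *)
Definition psdmx n (A : 'M[C]_n) : Prop :=
  forall v : 'cV[C]_n, 0 <= (adjmx v *m A *m v) 0 0.

Definition density_op n : set 'M[C]_n :=
  [set rho | [/\ rho \is hermsymmx, psdmx rho & \tr rho = 1]].

(* Tr[A B]; real, hence equal to its real part, for Hermitian [A] and [B]. *)
Definition rtr n (A B : 'M[C]_n) : R := complex.Re (\tr (A *m B)).

Definition commmx n (A B : 'M[C]_n) : 'M[C]_n := A *m B - B *m A.

Definition ptrace1 m n (A : 'M[C]_(m * n)) : 'M[C]_n :=
  \matrix_(i, j) \sum_(k < m) A (mxtens_index (k, i)) (mxtens_index (k, j)).

Definition ptrace2 m n (A : 'M[C]_(m * n)) : 'M[C]_m :=
  \matrix_(i, j) \sum_(k < n) A (mxtens_index (i, k)) (mxtens_index (j, k)).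

Definition traceless_onb d (F : 'I_(d ^ 2 - 1) -> 'M[C]_d) : Prop :=
  [/\ forall i, F i \is hermsymmx,
      forall i, \tr (F i) = 0,
      forall i j, \tr (F i *m F j) = (i == j)%:R
    & forall i, (opnorm (F i) <= 1)%E].

End Operators.

Section Wasserstein.
Context {R : realType} {dA dB : nat}.
Local Notation C := R[i].
Local Notation opAB := 'M[C]_(dA * dB).
Local Notation opAB2 := 'M[C]_((dA * dB) * (dA * dB)).

Definition separable_states : set opAB :=
  [set sigma | exists (n : nat) (p : 'I_n -> R)
      (sA : 'I_n -> 'M[C]_dA) (sB : 'I_n -> 'M[C]_dB),
    [/\ forall k, 0 <= p k, \sum_k p k = 1,
        forall k, density_op (sA k), forall k, density_op (sB k)
      & sigma = \sum_k (p k)%:C%C *: (sA k *t sB k)]].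

Definition couplings (rho sigma : opAB) : set opAB2 :=
  [set tau | [/\ density_op tau, ptrace2 tau = rho & ptrace1 tau = sigma]].

Definition lipnorm (H : opAB) : \bar R :=
  Order.max
    (ereal_sup [set opnorm (commmx (A *t (1%:M : 'M[C]_dB)) H) |
                A in [set A : 'M[C]_dA | (opnorm A <= 1)%E]])
    (ereal_sup [set opnorm (commmx ((1%:M : 'M[C]_dA) *t B) H) |
                B in [set B : 'M[C]_dB | (opnorm B <= 1)%E]]).

Variables (FA : 'I_(dA ^ 2 - 1) -> 'M[C]_dA) (FB : 'I_(dB ^ 2 - 1) -> 'M[C]_dB).

(* Under [traceless_onb] the listed operators are pairwise distinct, so summing
   over this sequence is summing over the set of its elements. *)
Definition cost_family : seq opAB :=
  [seq FA i *t (1%:M : 'M[C]_dB) | i <- enum 'I_(dA ^ 2 - 1)] ++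
  [seq (1%:M : 'M[C]_dA) *t FB j | j <- enum 'I_(dB ^ 2 - 1)].

Definition cost : opAB2 :=
  \sum_(X <- cost_family)
    (X *t (1%:M : opAB) - (1%:M : opAB) *t X) ^+ 2.

Definition wasserstein1 (rho sigma : opAB) : \bar R :=
  sqrte (ereal_inf [set (rtr cost tau)%:E | tau in couplings rho sigma]).

Definition wasserstein_ent (rho : opAB) : \bar R :=
  ereal_inf [set wasserstein1 rho sigma | sigma in separable_states].

End Wasserstein.

(* Main.v *)
(* Writing S_A, S_B for the swaps of the two copies of each factor, completeness
   of the orthonormal families gives C = 2(dA + dB) - 2 S_A - 2 S_B, hence
   C >= 2D - 2 - 2S with D = dA + dB and S = S_A S_B the full swap.  On the other
   hand G = H (x) 1 - 1 (x) H anticommutes with S, so in a vector a + b with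
   Sa = a, Sb = -b only the cross term contributes to G, and
   <G>^2 <= 4 s^2 |a|^2 |b|^2, where s bounds the length of the spectrum of H.
   It remains to have s small enough compared with D for this to be at most
   (|a|^2 + |b|^2) <C>.  Averaging H over a group of local unitaries bounds s by
   3 - 4 / (d 2^d) for either dimension d, which suffices unless dA = dB = 2; for
   two qubits a singular value decomposition gives the bound 1 + sqrt 2, for
   which the required inequality is an exact square.  The resulting operator
   inequality C + x^2 >= 2 x G is then traced against a coupling, with
   x = Tr[H rho] - Tr[H sigma]. *)

Require Import Defs.
From HB Require Import structures.
From mathcomp Require Import all_boot all_order all_algebra.
From mathcomp Require Import complex mxtens ring lra.
From mathcomp Require Import all_classical all_reals all_analysis.

Set Implicit Arguments.
Unset Strict Implicit.
Unset Printing Implicit Defensive.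

Import Order.TTheory GRing.Theory Num.Theory.

Local Open Scope classical_set_scope.
Local Open Scope ring_scope.
Local Open Scope sesquilinear_scope.

(** * Hermitian forms *)

Section HermitianForms.
Context {R : rcfType}.
Local Notation C := R[i].

Lemma Re_conjC (z : C) : complex.Re z^* = complex.Re z.
Proof. by case: z. Qed.

Lemma Re_add (z w : C) : complex.Re (z + w) = complex.Re z + complex.Re w.
Proof. by case: z; case: w. Qed.

Lemma Re_opp (z : C) : complex.Re (- z) = - complex.Re z.
Proof. by case: z. Qed.

Lemma Re_realM (r : R) (z : C) : complex.Re (r%:C%C * z) = r * complex.Re z.
Proof. by case: z => a b /=; rewrite mul0r subr0. Qed.

Lemma Re_sum I (r : seq I) (P : pred I) (F : I -> C) :
  complex.Re (\sum_(i <- r | P i) F i) = \sum_(i <- r | P i) complex.Re (F i).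
Proof. by apply: (big_morph (@complex.Re R)) => // x y; exact: Re_add. Qed.

Lemma conj_real (r : R) : (r%:C%C : C)^* = r%:C%C.
Proof. by apply/eqP; rewrite eq_complex /= oppr0 !eqxx. Qed.

(** Linear in the second argument. Positivity is left out, so that the forms of observables and
    their opposites are covered. *)
Definition hermform (V : lmodType C) (f : V -> V -> C) : Prop :=
  (forall v a w w', f v (a *: w + w') = a * f v w + f v w') /\
  (forall v w, f w v = (f v w)^*).

(** By conjugate symmetry [f v v] is real, so nothing is lost in taking its real part. *)
Definition qf (V : lmodType C) (f : V -> V -> C) (v : V) : R :=
  complex.Re (f v v).

Section Theory.
Variables (V : lmodType C) (f : V -> V -> C).
Hypothesis hf : hermform f.

Lemma hermform0r v : f v 0 = 0.
Proof.
have [lin _] := hf; apply: (addrI (f v 0)).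
by rewrite -{1}[f v 0]mul1r -lin scale1r !addr0.
Qed.

Lemma hermformDr v w w' : f v (w + w') = f v w + f v w'.
Proof. by have [lin _] := hf; rewrite -{1}[w]scale1r lin mul1r. Qed.

Lemma hermformZr v a w : f v (a *: w) = a * f v w.
Proof. by have [lin _] := hf; rewrite -[a *: w]addr0 lin hermform0r addr0. Qed.

Lemma hermformDl v v' w : f (v + v') w = f v w + f v' w.
Proof. by have [_ sym] := hf; rewrite !(sym w) hermformDr rmorphD. Qed.

Lemma hermformZl v a w : f (a *: v) w = a^* * f v w.
Proof. by have [_ sym] := hf; rewrite !(sym w) hermformZr rmorphM. Qed.

Lemma hermformNr v w : f v (- w) = - f v w.
Proof. by rewrite -scaleN1r hermformZr mulN1r. Qed.

Lemma hermformNl v w : f (- v) w = - f v w.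
Proof. by have [_ sym] := hf; rewrite !(sym w) hermformNr rmorphN. Qed.

Lemma hermform_sumr I (r : seq I) (P : pred I) (F : I -> V) v :
  f v (\sum_(i <- r | P i) F i) = \sum_(i <- r | P i) f v (F i).
Proof.
by apply: (big_morph (f v)) => [x y|]; rewrite ?hermformDr ?hermform0r.
Qed.

Lemma hermform_suml I (r : seq I) (P : pred I) (F : I -> V) v :
  f (\sum_(i <- r | P i) F i) v = \sum_(i <- r | P i) f (F i) v.
Proof.
have [_ sym] := hf; rewrite sym hermform_sumr rmorph_sum.
by apply: eq_bigr => i _; rewrite [RHS]sym.
Qed.

Lemma Re_hermformC v w : complex.Re (f w v) = complex.Re (f v w).
Proof. by have [_ sym] := hf; rewrite sym Re_conjC. Qed.

Lemma qf0 : qf f 0 = 0.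
Proof. by rewrite /qf hermform0r. Qed.

Lemma qfD v w : qf f (v + w) = qf f v + qf f w + 2 * complex.Re (f v w).
Proof.
rewrite /qf hermformDl !hermformDr !Re_add (Re_hermformC v w); ring.
Qed.

Lemma qfZ_real (r : R) v : qf f (r%:C%C *: v) = r ^+ 2 * qf f v.
Proof. by rewrite /qf hermformZl hermformZr conj_real !Re_realM expr2 mulrA. Qed.

Lemma qfZ_phase (c : C) v : c^* * c = 1 -> qf f (c *: v) = qf f v.
Proof. by move=> c1; rewrite /qf hermformZl hermformZr mulrA c1 mul1r. Qed.

Lemma qfN v : qf f (- v) = qf f v.
Proof. by rewrite -scaleN1r qfZ_phase // rmorphN1 mulrNN mulr1. Qed.

Lemma qf_sum (I : finType) (F : I -> V) :
  qf f (\sum_i F i) = \sum_i \sum_j complex.Re (f (F i) (F j)).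
Proof.
rewrite /qf hermform_suml Re_sum; apply: eq_bigr => i _.
by rewrite hermform_sumr Re_sum.
Qed.

Lemma qfB v w : qf f (v - w) = qf f v + qf f w - 2 * complex.Re (f v w).
Proof.
by rewrite qfD qfN hermformNr Re_opp mulrN.
Qed.

Lemma hermformN : hermform (fun v w => - f v w).
Proof.
have [lin sym] := hf; split=> [v a w w'|v w]; last by rewrite sym rmorphN.
by rewrite lin opprD mulrN.
Qed.

Lemma hermform_comp (W : lmodType C) (g : {linear W -> V}) :
  hermform (fun v w => f (g v) (g w)).
Proof.
have [lin sym] := hf; split=> [v a w w'|v w]; last exact: sym.
by rewrite linearP lin.
Qed.

(** Discriminant bound for a nonnegative quadratic polynomial in the real scalars [s] and [t]; the
    form [f] itself may be indefinite. *)
Lemma qf_cauchy_schwarz (n p : R) v w :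
    (forall t s : R, 4 * complex.Re (f (s%:C%C *: v) (t%:C%C *: w)) <=
       s ^+ 2 * n + t ^+ 2 * p) -> 0 <= n -> 0 <= p ->
  (2 * complex.Re (f v w)) ^+ 2 <= n * p.
Proof.
move=> H n0 p0; set b := complex.Re (f v w).
have Hb t s : 4 * (s * t * b) <= s ^+ 2 * n + t ^+ 2 * p.
  have := H t s; rewrite hermformZl hermformZr conj_real !Re_realM -/b; lra.
(* For [p = 0] the hypothesis is affine in [t], so a suitable [t] contradicts a nonzero [b]. *)
have [p_eq0|p_neq0] := eqVneq p 0.
  have [b0|b0] := eqVneq b 0; first by rewrite b0 p_eq0 mulr0 expr0n /= mulr0.
  have := Hb ((n + 1) / b) 1.
  by rewrite p_eq0 mul1r divfK // expr1n; lra.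
(* For [s = p] the quadratic in [t] attains its minimum at [t = 2 b]. *)
have Hp := Hb (2 * b) p; have pp : 0 < p by rewrite lt_neqAle eq_sym p_neq0.
by rewrite -(ler_pM2l pp); lra.
Qed.

(** Under uniformly random signs the cross terms average to zero, and the diagonal terms do not
    change. *)
Lemma qf_signs m (F : 'I_m -> V) :
  \sum_(e : {ffun 'I_m -> bool}) qf f (\sum_j (-1) ^+ e j *: F j) =
  2 ^+ m * \sum_j qf f (F j).
Proof.
have sgn (e : {ffun 'I_m -> bool}) i j :
  complex.Re (f ((-1) ^+ e i *: F i) ((-1) ^+ e j *: F j)) =
    ((-1) ^+ e i * (-1) ^+ e j) * complex.Re (f (F i) (F j)).
  have -> : (-1 : C) = (-1)%:C%C by rewrite rmorphN1.
  by rewrite -!rmorphXn hermformZl hermformZr conj_real !Re_realM mulrA.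
under eq_bigr do rewrite qf_sum.
rewrite exchange_big mulr_sumr; apply: eq_bigr => i _ /=.
rewrite exchange_big (bigD1 i) //= [X in _ + X]big1 ?addr0 => [|j ji].
  under eq_bigr do rewrite sgn -expr2 sqrr_sign mul1r.
  by rewrite sumr_const card_ffun card_bool card_ord -natrX mulr_natl.
under eq_bigr do rewrite sgn.
rewrite -mulr_suml; set S := (X in X * _).
suff SN : S = - S by have -> : S = 0; [clearbody S; lra|rewrite mul0r].
(* Flipping the sign at [i] permutes the sign patterns and negates the sum. *)
pose h (e : {ffun 'I_m -> bool}) := [ffun k => (k == i) (+) e k].
have hK : involutive h.
  by move=> e; apply/ffunP => k; rewrite !ffunE addKb.
rewrite {1}/S (reindex_inj (inv_inj hK)) -sumrN; apply: eq_bigr => e _.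
by rewrite !ffunE eqxx (negPf ji) /= signrN mulNr.
Qed.
End Theory.

(** Division-free form of [q v / n v - q w / n w <= s]. For the form of an observable and the
    squared norm, [s] bounds the length of the spectrum. *)
Definition spread (V : lmodType C) (q n : V -> R) (s : R) : Prop :=
  forall v w, n w * q v - n v * q w <= s * (n v * n w).

(** Both sides expand over the pairs [(i, j)]. The families will be the rows or the columns of a
    matrix. *)
Lemma spread_sum (I J : finType) (a n : I -> R) (b p : J -> R) s :
    (forall i j, p j * a i - n i * b j <= s * (n i * p j)) ->
  (\sum_j p j) * (\sum_i a i) - (\sum_i n i) * (\sum_j b j) <=
    s * ((\sum_i n i) * (\sum_j p j)).
Proof.
move=> H; rewrite [X in X - _]mulrC !big_distrlr /= -sumrB mulr_sumr.
apply: ler_sum => i _; rewrite -sumrB mulr_sumr; apply: ler_sum => j _.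
by rewrite [a i * _]mulrC.
Qed.
End HermitianForms.

(** * Forms on matrices *)

Section MatrixForms.
Context {R : rcfType}.
Local Notation C := R[i].

Lemma adjM m n p (A : 'M[C]_(m, n)) (B : 'M[C]_(n, p)) :
  (A *m B)^t* = B^t* *m A^t*.
Proof. by rewrite trmx_mul map_mxM. Qed.

Lemma unitarymxVl n (U : 'M[C]_n) : U \is unitarymx -> U^t* *m U = 1%:M.
Proof. by move/unitarymxP/mulmx1C. Qed.

(** The Hilbert-Schmidt inner product; its squared norm is written [n2] below. *)
Definition frob m n (M N : 'M[C]_(m, n)) : C := \tr (M^t* *m N).

Local Notation n2 := (qf (@frob _ _)).

Lemma hermform_frob m n : hermform (@frob m n).
Proof.
split=> [M a N N'|M N]; first by rewrite /frob mulmxDr -scalemxAr mxtraceD mxtraceZ.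
by rewrite /frob -[in LHS](trmxCK M) -adjM trace_map_mx mxtrace_tr.
Qed.

Lemma frobE m n (M N : 'M[C]_(m, n)) :
  frob M N = \sum_i \sum_j (M i j)^* * N i j.
Proof.
rewrite /frob /mxtrace exchange_big; apply: eq_bigr => i _ /=.
by rewrite !mxE; apply: eq_bigr => j _; rewrite !mxE.
Qed.

Lemma Re_mulJ (z : C) : complex.Re (z^* * z) = complex.Re z ^+ 2 + complex.Im z ^+ 2.
Proof. by case: z => a b /=; rewrite mulNr opprK. Qed.

Lemma n2E m n (M : 'M[C]_(m, n)) :
  n2 M = \sum_i \sum_j complex.Re ((M i j)^* * M i j).
Proof.
by rewrite /qf frobE Re_sum; apply: eq_bigr => i _; rewrite Re_sum.
Qed.

Lemma n2_ge0 m n (M : 'M[C]_(m, n)) : 0 <= n2 M.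
Proof.
rewrite n2E; apply: sumr_ge0 => i _; apply: sumr_ge0 => j _.
by rewrite Re_mulJ addr_ge0 ?sqr_ge0.
Qed.

Lemma n2_eq0 m n (M : 'M[C]_(m, n)) : n2 M = 0 -> M = 0.
Proof.
have ge0 i j : 0 <= complex.Re ((M i j)^* * M i j).
  by rewrite Re_mulJ addr_ge0 ?sqr_ge0.
rewrite n2E => /eqP; rewrite psumr_eq0 => [/allP H|i _]; last exact: sumr_ge0.
apply/matrixP => i j; rewrite mxE; have := H i; rewrite mem_index_enum => /(_ isT).
rewrite psumr_eq0 // => /allP /(_ j); rewrite mem_index_enum => /(_ isT).
rewrite Re_mulJ paddr_eq0 ?sqr_ge0 // !sqrf_eq0 => /andP[/eqP a0 /eqP b0].
by apply/eqP; rewrite eq_complex /= a0 b0 eqxx.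
Qed.

Lemma n2_frob m n (M : 'M[C]_(m, n)) : frob M M = (n2 M)%:C%C.
Proof.
apply/eqP; rewrite eq_complex eqxx /=; apply/eqP.
have [_ /(_ M M)] := hermform_frob m n.
by case: (frob M M) => a b [] /=; lra.
Qed.

Lemma n2_tr m n (M : 'M[C]_(m, n)) : n2 M^T = n2 M.
Proof.
rewrite !n2E exchange_big; apply: eq_bigr => i _; apply: eq_bigr => j _.
by rewrite mxE.
Qed.

Lemma n2_rows m n (M : 'M[C]_(m, n)) : n2 M = \sum_i n2 (row i M).
Proof.
rewrite n2E; apply: eq_bigr => i _; rewrite n2E big_ord1.
by apply: eq_bigr => j _; rewrite mxE.
Qed.

Lemma n2_mull m n (U : 'M[C]_m) (M : 'M[C]_(m, n)) :
  U \is unitarymx -> n2 (U *m M) = n2 M.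
Proof.
by move=> hU; rewrite /qf /frob adjM -mulmxA [U^t* *m _]mulmxA unitarymxVl ?mul1mx.
Qed.

Lemma n2_mulr m n (U : 'M[C]_n) (M : 'M[C]_(m, n)) :
  U \is unitarymx -> n2 (M *m U) = n2 M.
Proof.
by move=> hU; rewrite -n2_tr trmx_mul n2_mull ?trmx_unitary // n2_tr.
Qed.

Lemma n2_delta m n (k : 'I_m) (x : 'rV[C]_n) : n2 (delta_mx k 0 *m x) = n2 x.
Proof.
rewrite n2_rows (bigD1 k) //= [X in _ + X]big1 ?addr0 => [|i ik].
  by congr n2; apply/rowP => j; rewrite !mxE big_ord1 mxE !eqxx mul1r.
suff -> : row i (delta_mx k 0 *m x) = 0 by rewrite (qf0 (hermform_frob _ _)).
by apply/rowP => j; rewrite !mxE big_ord1 mxE (negPf ik) mul0r.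
Qed.

Lemma sum_delta_rows m n (M : 'M[C]_(m, n)) :
  M = \sum_k delta_mx k 0 *m row k M.
Proof.
apply/matrixP => i j; rewrite summxE (bigD1 i) //= big1 ?addr0 => [|k ki].
  by rewrite !mxE big_ord1 !mxE !eqxx mul1r.
by rewrite !mxE big_ord1 !mxE eq_sym (negPf ki) mul0r.
Qed.

(* The reflection exchanging [x] and [c *: z], where the phase [c] makes their
   inner product real. *)
Lemma householder n (x z : 'rV[C]_n) : n2 x = n2 z ->
  exists2 V : 'M[C]_n, V \is unitarymx &
    exists2 c : C, c^* * c = 1 & x *m V = c *: z.
Proof.
move=> xz; have hn := hermform_frob 1 n.
pose d := frob z x.
have [c c1 cd] : exists2 c : C, c^* * c = 1 & (c^* * d)^* = c^* * d.
  have [->|d0] := eqVneq d 0.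
    by exists 1; rewrite ?rmorph1 ?mulr1 // mulr0 rmorph0.
  exists (d / `|d|).
    rewrite rmorphM fmorphV /= conj_normC mulrACA -invfM -expr2 -normCKC.
    by rewrite mulfV // expf_neq0 // normr_eq0.
  rewrite !rmorphM !fmorphV /= !conjCK !conj_normC.
  by rewrite mulrAC [RHS]mulrAC [d^* * _]mulrC.
pose w := x - c *: z; pose nu := n2 w.
have [w0|w0] := eqVneq w 0.
  exists 1%:M; first by apply/unitarymxP; rewrite trmx1 map_mx1 mulmx1.
  by exists c => //; rewrite mulmx1; apply/eqP; rewrite -subr_eq0 -/w w0.
have nu0 : nu%:C%C != 0 :> C.
  by apply: contraNneq w0 => -[/n2_eq0 ->].
(* Equal norms and a real inner product give [x] and [- c *: z] the same inner product with [w];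
   their sum is [w], so each inner product is half the squared norm of [w]. *)
have xw : frob w x = nu%:C%C / 2.
  have cdr : frob (c *: z) x = frob x (c *: z).
    by rewrite (hn.2 (c *: z)) hermformZl // cd.
  have hw : frob w w = frob w x + frob w x.
    have wx : frob w x + frob w (c *: z) = 0.
      rewrite /w !(hermformDl hn) !(hermformNl hn) cdr !n2_frob qfZ_phase // xz; ring.
    rewrite {2}/w (hermformDr hn) (hermformNr hn).
    have -> : frob w (c *: z) = - frob w x.
      by apply/eqP; rewrite -addr_eq0 addrC wx.
    by rewrite opprK.
  by rewrite /nu -n2_frob hw -[_ + _]mulr2n -[_ *+ 2]mulr_natr mulfK ?pnatr_eq0.
have dotE (a b : 'rV[C]_n) : a *m b^t* = (frob b a)%:M.
  by rewrite [LHS]mx11_scalar /frob mxtrace_mulC trace_mx11.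
pose k : C := 2 / nu%:C%C.
have kJ : k^* = k by rewrite rmorphM fmorphV rmorph_nat /= conj_real.
exists (1%:M - k *: (w^t* *m w)).
  apply/unitarymxP.
  have -> : (1%:M - k *: (w^t* *m w))^t* = 1%:M - k *: (w^t* *m w).
    rewrite linearB /= map_mxB trmx1 map_mx1 linearZ /= map_mxZ.
    by rewrite -[map_mx _ (_ *m _)^T]/((_ *m _)^t*) adjM trmxCK /= kJ.
  have PP : (w^t* *m w) *m (w^t* *m w) = nu%:C%C *: (w^t* *m w).
    by rewrite -mulmxA [w *m _]mulmxA dotE n2_frob mul_scalar_mx -scalemxAr.
  have knu : k * k * nu%:C%C = k + k.
    by rewrite -mulrA {2}/k divfK // mulr_natr.
  rewrite mulmxBr mulmx1 mulmxBl mul1mx -scalemxAl -scalemxAr PP !scalerA.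
  by rewrite knu scalerDl opprB addrK subrK.
exists c => //.
rewrite mulmxBr mulmx1 -scalemxAr mulmxA dotE xw mul_scalar_mx scalerA.
by rewrite /k mulrA divfK // divff ?pnatr_eq0 // scale1r opprB addrC subrK.
Qed.
End MatrixForms.

(** * Averaging over local unitaries *)

Section Lipschitz.
Context {R : rcfType}.
Local Notation C := R[i].
Local Notation n2 := (qf (@frob _ _ _)).

(** What is used of the Lipschitz bound on the first tensor factor, whose unitaries act on a
    coordinate matrix [M] by left multiplication. *)
Definition lipL m n (f : 'M[C]_(m, n) -> 'M[C]_(m, n) -> C) : Prop :=
  forall U : 'M[C]_m, U \is unitarymx ->
  forall M, qf f M - qf f (U *m M) <= n2 M.

Definition lipR m n (f : 'M[C]_(m, n) -> 'M[C]_(m, n) -> C) : Prop :=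
  forall U : 'M[C]_n, U \is unitarymx ->
  forall M, qf f M - qf f (M *m U) <= n2 M.

Lemma qf_opp (V : lmodType C) (f : V -> V -> C) v :
  qf (fun v w => - f v w) v = - qf f v.
Proof. exact: Re_opp. Qed.

(** The bound for the inverse unitary, taken at [U *m M], is the bound for the opposite form. *)
Lemma lipL_opp m n (f : 'M[C]_(m, n) -> 'M[C]_(m, n) -> C) :
  lipL f -> lipL (fun M N => - f M N).
Proof.
move=> lf U hU M; rewrite !qf_opp opprK addrC -(n2_mull M hU).
rewrite -[X in qf f _ - qf f X]mul1mx -(unitarymxVl hU) -mulmxA.
by apply: lf; rewrite trmxC_unitary.
Qed.

Lemma lipR_opp m n (f : 'M[C]_(m, n) -> 'M[C]_(m, n) -> C) :
  lipR f -> lipR (fun M N => - f M N).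
Proof.
move=> lf U hU M; rewrite !qf_opp opprK addrC -(n2_mulr M hU).
rewrite -[X in qf f _ - qf f X]mulmx1 -(unitarymxP hU) mulmxA.
by apply: lf; rewrite trmxC_unitary.
Qed.

(** Product vectors with the same first factor [e_k], once rescaled to equal norms, differ up to a
    phase by a unitary of the second factor. *)
Lemma lipR_spread_row m n (f : 'M[C]_(m, n) -> 'M[C]_(m, n) -> C) (k : 'I_m) :
  hermform f -> lipR f ->
  spread (fun x : 'rV[C]_n => qf f (delta_mx k 0 *m x)) n2 1.
Proof.
move=> hf lf x z; rewrite mul1r.
have hn := @hermform_frob R 1 n.
pose r := Num.sqrt (n2 x); pose t := Num.sqrt (n2 z).
have r2 : r ^+ 2 = n2 x by rewrite sqr_sqrtr // n2_ge0.
have t2 : t ^+ 2 = n2 z by rewrite sqr_sqrtr // n2_ge0.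
(* Each vector is scaled by the norm of the other, which equalizes the norms without division. *)
have [|V hV [c c1 eV]] := @householder R n (t%:C%C *: x) (r%:C%C *: z).
  by rewrite !(qfZ_real hn) r2 t2 mulrC.
have := lf V hV (delta_mx k 0 *m (t%:C%C *: x)).
rewrite -mulmxA eV n2_delta -!scalemxAr (qfZ_phase hf _ c1) !(qfZ_real hf).
by rewrite (qfZ_real hn) r2 t2 [n2 z * n2 x]mulrC.
Qed.

(* Average over the matrices [U e k] of signed cyclic shifts; the [- 2] comes
   from the two of them, [1] and [-1], that do not move [M]. *)
Lemma lipL_average p n (f : 'M[C]_(p.+1, n) -> 'M[C]_(p.+1, n) -> C) M :
    hermform f -> lipL f ->
  2 ^+ p.+1 * p.+1%:R * qf f M <= (2 ^+ p.+1 * p.+1%:R - 2) * n2 M +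
    2 ^+ p.+1 * \sum_k \sum_i qf f (delta_mx k 0 *m row i M).
Proof.
move=> hf lf.
pose U (e : {ffun 'I_p.+1 -> bool}) (k : 'I_p.+1) : 'M[C]_p.+1 :=
  \matrix_(i, j) ((-1) ^+ e i *+ (j == i + k)).
have unitU e k : U e k \is unitarymx.
  apply/unitarymxP/matrixP => i j; rewrite !mxE (bigD1 (i + k)) //= big1 => [|l li].
    rewrite addr0 !mxE eqxx mulr1n (inj_eq (addIr k)).
    have [->|] := eqVneq i j; last by rewrite mulr0n rmorph0 mulr0.
    by rewrite mulr1n rmorph_sign -signr_addb addbb.
  by rewrite !mxE (negPf li) mulr0n mul0r.
have UM e k : U e k *m M =
    \sum_i (-1) ^+ e i *: (delta_mx i 0 *m row (i + k) M).
  apply/matrixP => i j; rewrite summxE !mxE (bigD1 (i + k)) //= big1 => [|l li].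
    rewrite (bigD1 i) //= big1 => [|l li].
      by rewrite !mxE big_ord1 !mxE !eqxx mulr1n mul1r.
    by rewrite !mxE big_ord1 !mxE eq_sym (negPf li) mul0r mulr0.
  by rewrite !mxE (negPf li) mulr0n mul0r.
have U1 k b : k = 0 -> qf f (U [ffun=> b] k *m M) = qf f M.
  move=> ->; rewrite UM; under eq_bigr do rewrite ffunE addr0.
  rewrite -scaler_sumr -sum_delta_rows qfZ_phase // rmorph_sign.
  by rewrite -signr_addb addbb.
(* [c b] is the indicator of the one pair where [U e k] is [(-1) ^+ b] times the identity; there the
   difference is zero. *)
pose c b (e : {ffun 'I_p.+1 -> bool}) (k : 'I_p.+1) : R :=
  ((k == 0) && (e == [ffun=> b]))%:R.
have le e k : qf f M - qf f (U e k *m M) <= (1 - c false e k - c true e k) * n2 M.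
  have := lf _ (unitU e k) M; rewrite /c; case: (eqVneq k 0) => [k0|_] /=; last by rewrite !subr0 mul1r.
  have [->|e0] := eqVneq e [ffun=> false].
    rewrite U1 // subrr.
    suff /negPf -> : [ffun=> false] != [ffun=> true] :> {ffun 'I_p.+1 -> bool}.
      by rewrite subr0 subrr mul0r.
    by apply/eqP => /ffunP/(_ 0); rewrite !ffunE.
  have [->|_] := eqVneq e [ffun=> true]; last by rewrite !subr0 mul1r.
  by rewrite U1 // subrr subr0 subrr mul0r.
have sumc b : \sum_e \sum_k c b e k = 1.
  rewrite (bigD1 [ffun=> b]) //= [X in _ + X]big1 ?addr0 => [|e eb].
    rewrite (bigD1 (0 : 'I_p.+1)) //= big1 ?addr0 => [|k k0]; first by rewrite /c !eqxx.
    by rewrite /c (negPf k0).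
  by apply: big1 => k _; rewrite /c (negPf eb) andbF.
have sum1 (x : R) : \sum_(e : {ffun 'I_p.+1 -> bool}) \sum_(k < p.+1) x =
    2 ^+ p.+1 * p.+1%:R * x.
  rewrite !sumr_const card_ffun card_bool !card_ord -mulrnA -natrX -natrM.
  by rewrite mulr_natl mulnC.
have: \sum_e \sum_k (qf f M - qf f (U e k *m M)) <=
      \sum_e \sum_k (1 - c false e k - c true e k) * n2 M.
  by apply: ler_sum => e _; apply: ler_sum => k _; exact: le.
under eq_bigr do rewrite sumrB.
under [X in _ <= X]eq_bigr do rewrite -mulr_suml !sumrB.
rewrite sumrB -mulr_suml !sumrB !sumc !sum1 mulr1.
(* The signs remove the cross terms, and the shifts bring every row of [M] to every position
   once. *)
have -> : \sum_e \sum_k qf f (U e k *m M) =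
    2 ^+ p.+1 * \sum_k \sum_i qf f (delta_mx k 0 *m row i M).
  rewrite exchange_big /=.
  under eq_bigr do under eq_bigr do rewrite UM.
  under eq_bigr do rewrite qf_signs //.
  rewrite -mulr_sumr exchange_big /=; congr (_ * _); apply: eq_bigr => i _.
  by rewrite [RHS](reindex_inj (addrI i)).
lra.
Qed.

(** With [d = p.+1] and [L = d 2^d], averaging costs [1 - 2 / L] for [M] and the same for [N]. The
    averages involve product vectors only, and comparing those with a common first factor costs [1]
    more. *)
Lemma lip_spread p n (f : 'M[C]_(p.+1, n) -> 'M[C]_(p.+1, n) -> C) :
    hermform f -> lipL f -> lipR f ->
  spread (qf f) n2 (3 - 4 / (2 ^+ p.+1 * p.+1%:R)).
Proof.
move=> hf lL lR M N.
have A1 := lipL_average M hf lL.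
have A2 := lipL_average N (hermformN hf) (lipL_opp lL).
have oppS : \sum_k \sum_i qf (fun M N => - f M N) (delta_mx k 0 *m row i N) =
    - \sum_k \sum_i qf f (delta_mx k 0 *m row i N).
  rewrite -sumrN; apply: eq_bigr => k _.
  by rewrite -sumrN; apply: eq_bigr => i _; rewrite qf_opp.
rewrite qf_opp oppS in A2.
set S1 := \sum_k _ in A1; set S2 := \sum_k _ in A2.
have S12 : n2 N * S1 - n2 M * S2 <= p.+1%:R * (n2 M * n2 N).
  rewrite /S1 /S2 !mulr_sumr -sumrB mulr_natl.
  have -> : n2 M * n2 N *+ p.+1 = \sum_(k < p.+1) n2 M * n2 N.
    by rewrite sumr_const card_ord.
  apply: ler_sum => k _; rewrite (n2_rows M) (n2_rows N) -[leRHS]mul1r.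
  by apply: spread_sum => i j; exact: (lipR_spread_row k hf lR).
have L0 : 0 < 2 ^+ p.+1 * p.+1%:R :> R by rewrite mulr_gt0 ?exprn_gt0 ?ltr0n.
rewrite -(ler_pM2l L0) [leRHS]mulrA [X in _ <= X * _]mulrBr.
rewrite [_ * (4 / _)]mulrC divfK ?gt_eqF //.
have P0 : 0 < 2 ^+ p.+1 :> R by rewrite exprn_gt0.
have nM := n2_ge0 M; have nN := n2_ge0 N.
move: A1 A2 S12 L0; rewrite -/S1 -/S2.
move: (2 ^+ p.+1 : R) (p.+1%:R : R) P0 => L m P0 A1 A2 S12 L0.
have B1 := ler_wpM2l nN A1; have B2 := ler_wpM2l nM A2.
have B3 := ler_wpM2l (ltW P0) S12.
clear -B1 B2 B3.
lra.
Qed.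
End Lipschitz.

(** * Two qubits *)

Section TwoQubits.
Context {R : rcfType}.
Local Notation C := R[i].
Local Notation n2 := (qf (@frob _ _ _)).

Lemma qfZ (V : lmodType C) (f : V -> V -> C) (a : C) v :
  hermform f -> qf f (a *: v) = complex.Re (a^* * a) * qf f v.
Proof.
move=> hf; rewrite /qf (hermformZl hf) (hermformZr hf) mulrA.
suff {1}-> : a^* * a = (complex.Re (a^* * a))%:C%C by rewrite Re_realM.
apply/eqP; rewrite eq_complex eqxx /=.
by case: a => a b /=; rewrite mulNr [b * a]mulrC subrr.
Qed.

(** Transposing coordinate matrices exchanges the tensor factors, and with them the left and right
    Lipschitz conditions. *)
Lemma hermform_tr m n (f : 'M[C]_(m, n) -> 'M[C]_(m, n) -> C) :
  hermform f -> hermform (fun M N : 'M[C]_(n, m) => f M^T N^T).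
Proof. by move=> hf; exact: (hermform_comp hf (@trmx C n m)). Qed.

Lemma lipL_tr m n (f : 'M[C]_(m, n) -> 'M[C]_(m, n) -> C) :
  lipR f -> lipL (fun M N : 'M[C]_(n, m) => f M^T N^T).
Proof.
move=> lf U hU M; have := lf U^T _ M^T; rewrite trmx_unitary n2_tr -trmx_mul.
exact.
Qed.

Lemma lipR_tr m n (f : 'M[C]_(m, n) -> 'M[C]_(m, n) -> C) :
  lipL f -> lipR (fun M N : 'M[C]_(n, m) => f M^T N^T).
Proof.
move=> lf U hU M; have := lf U^T _ M^T; rewrite trmx_unitary n2_tr -trmx_mul.
exact.
Qed.

Lemma spread_tr m n (f : 'M[C]_(m, n) -> 'M[C]_(m, n) -> C) s :
  spread (qf (fun M N : 'M[C]_(n, m) => f M^T N^T)) n2 s -> spread (qf f) n2 s.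
Proof.
by move=> sf M N; have := sf M^T N^T; rewrite !n2_tr /qf !trmxK.
Qed.

(** The sum is the trace of the form, the same in every orthonormal basis. *)
Lemma sum_qf_delta_mull m n (f : 'M[C]_(m, n) -> 'M[C]_(m, n) -> C) (U : 'M[C]_m) :
    hermform f -> U \is unitarymx ->
  \sum_i \sum_j qf f (U *m delta_mx i j) = \sum_i \sum_j qf f (delta_mx i j).
Proof.
move=> hf /unitarymxP hU; rewrite exchange_big [RHS]exchange_big /=.
apply: eq_bigr => j _.
have UE i : U *m delta_mx i j = \sum_k U k i *: delta_mx k j.
  apply/matrixP => a b; rewrite summxE !mxE (bigD1 i) //= big1 => [|l li].
    rewrite (bigD1 a) //= big1 => [|l la]; rewrite !mxE.
      by rewrite !eqxx !addr0.
    by rewrite eq_sym (negPf la) mulr0.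
  by rewrite mxE (negPf li) mulr0.
under eq_bigr do rewrite UE qf_sum //.
rewrite exchange_big; apply: eq_bigr => k _ /=; rewrite exchange_big /=.
transitivity (\sum_l complex.Re ((U *m U^t*) l k * f (delta_mx k j) (delta_mx l j))).
  apply: eq_bigr => l _; rewrite -Re_sum; congr complex.Re.
  rewrite mxE mulr_suml; apply: eq_bigr => i _.
  by rewrite hermformZl // hermformZr // !mxE mulrA [_^* * _]mulrC.
rewrite hU (bigD1 k) //= big1 => [|l lk]; rewrite mxE; last by rewrite (negPf lk) mul0r.
by rewrite eqxx mul1r addr0.
Qed.

Lemma sum_qf_delta_mulr m n (f : 'M[C]_(m, n) -> 'M[C]_(m, n) -> C) (U : 'M[C]_n) :
    hermform f -> U \is unitarymx ->
  \sum_i \sum_j qf f (delta_mx i j *m U) = \sum_i \sum_j qf f (delta_mx i j).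
Proof.
move=> hf hU; have hUT : U^T \is unitarymx by rewrite trmx_unitary.
have := sum_qf_delta_mull (hermform_tr hf) hUT.
rewrite exchange_big [RHS]exchange_big /= => H.
transitivity (\sum_i \sum_j qf (fun M N => f M^T N^T) (U^T *m delta_mx j i)).
  by apply: eq_bigr => i _; apply: eq_bigr => j _; rewrite /qf trmx_mul trmxK trmx_delta.
rewrite H; apply: eq_bigr => i _; apply: eq_bigr => j _.
by rewrite /qf trmx_delta.
Qed.

Lemma n2_delta_row n (i : 'I_n) : n2 (delta_mx 0 i : 'rV[C]_n) = 1.
Proof.
rewrite n2E big_ord1 (bigD1 i) //= big1 => [|j ji].
  by rewrite !mxE !eqxx mulr1 conjC1 addr0.
by rewrite !mxE (negPf ji) andbF mulr0.
Qed.

(** Diagonalizing [M *m M^t*] makes the rows of [P *m M] orthogonal. A unitary on the right then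
    puts the first row on the first axis, which forces the second row onto the second axis. *)
Lemma svd22 (M : 'M[C]_2) : exists P V : 'M[C]_2,
  [/\ P \is unitarymx, V \is unitarymx, (P *m M *m V) 0 1 = 0
    & (P *m M *m V) 1 0 = 0].
Proof.
have : M *m M^t* \is normalmx by apply/normalmxP; rewrite adjM trmxCK.
case/orthomx_spectral_subproof=> -[P sp] /= hP eP; set N := P *m M.
have rows : N *m N^t* = diag_mx sp.
  rewrite /N adjM mulmxA -[P *m M *m _]mulmxA eP invmx_unitary //.
  by rewrite !mulmxA (unitarymxP hP) mul1mx -mulmxA (unitarymxP hP) mulmx1.
have col (V : 'M[C]_2) : V \is unitarymx -> \sum_j (N *m V) 0 j * ((N *m V) 1 j)^* = 0.
  move=> /unitarymxP hV; transitivity (((N *m V) *m (N *m V)^t*) 0 1).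
    rewrite [RHS]mxE; apply: eq_bigr => j _.
    by congr (_ * _); rewrite [RHS]mxE [in RHS]mxE.
  by rewrite adjM mulmxA -[N *m V *m _]mulmxA hV mulmx1 rows mxE.
have align (k l : 'I_2) : exists2 V : 'M[C]_2, V \is unitarymx &
    exists2 c : C, c^* * c = 1 & row k N *m V =
      c *: ((Num.sqrt (n2 (row k N)))%:C%C *: delta_mx 0 l).
  apply: householder; rewrite (qfZ_real (hermform_frob 1 2)).
  by rewrite sqr_sqrtr ?n2_ge0 // n2_delta_row mulr1.
have rowE k (V : 'M[C]_2) j : (N *m V) k j = (row k N *m V) 0 j.
  by rewrite -row_mul [RHS]mxE.
(* Orthogonality to a zero row says nothing, so here the second row is rotated instead. *)
have [x0|x0] := eqVneq (row 0 N) 0.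
  have [V hV [c _ cE]] := align 1 1; exists P, V; split=> //.
    by rewrite -/N rowE x0 mul0mx mxE.
  rewrite -/N rowE cE !mxE; by rewrite /= ?mulr0n !mulr0.
have [V hV [c c1 cE]] := align 0 0.
have x1 : (N *m V) 0 1 = 0 by rewrite rowE cE !mxE /= !mulr0.
have xr : (N *m V) 0 0 = c * (Num.sqrt (n2 (row 0 N)))%:C%C.
  by rewrite rowE cE !mxE !eqxx mulr1.
exists P, V; split=> //.
have := col V hV; rewrite -/N !big_ord_recl big_ord0 addr0.
have -> : lift ord0 ord0 = 1 :> 'I_2 by apply: val_inj.
rewrite x1 xr mul0r addr0 => /eqP.
have c0 : c != 0 by apply: contraPneq c1 => ->; rewrite mulr0 => /esym/eqP; rewrite oner_eq0.
have r0 : (Num.sqrt (n2 (row 0 N)))%:C%C != 0 :> C.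
  apply: contraNneq x0 => -[/eqP]; rewrite sqrtr_eq0 => le0.
  by apply/eqP/n2_eq0/eqP; rewrite eq_le le0 n2_ge0.
by rewrite !mulf_eq0 (negPf c0) (negPf r0) /= conjC_eq0 => /eqP.
Qed.

(** The constant is the mean of the form over the product basis plus half of the spread aimed at.
    Values at basis vectors sharing an index differ by at most 1, and a local sign flip controls the
    cross term. *)
Lemma lip22_diag (f : 'M[C]_2 -> 'M[C]_2 -> C) (D : 'M[C]_2) :
    hermform f -> lipL f -> lipR f -> D 0 1 = 0 -> D 1 0 = 0 ->
  qf f D <= ((\sum_i \sum_j qf f (delta_mx i j)) / 4 + (1 + Num.sqrt 2) / 2) * n2 D.
Proof.
move=> hf lL lR D01 D10; have hn := @hermform_frob R 2 2.
pose v : 'M[C]_2 := D 0 0 *: delta_mx 0 0.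
pose w : 'M[C]_2 := D 1 1 *: delta_mx 1 1.
have e1 : lift ord0 ord0 = 1 :> 'I_2 by apply: val_inj.
have DE : D = v + w.
  rewrite [LHS]matrix_sum_delta !big_ord_recl !big_ord0 !e1 D01 D10.
  by rewrite !scale0r !addr0 add0r.
have sumE : \sum_i \sum_j qf f (delta_mx i j : 'M[C]_2) =
    qf f (delta_mx 0 0) + qf f (delta_mx 0 1) +
    (qf f (delta_mx 1 0) + qf f (delta_mx 1 1)).
  by rewrite !big_ord_recl !big_ord0 !addr0 e1.
have hj (i j k : 'I_2) : qf f (delta_mx i j) - qf f (delta_mx i k) <= 1.
  have := lipR_spread_row i hf lR (delta_mx 0 j) (delta_mx 0 k).
  by rewrite !n2_delta_row !mul1r !mul_delta_mx.
have hi (i j k : 'I_2) : qf f (delta_mx j i) - qf f (delta_mx k i) <= 1.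
  have := lipR_spread_row i (hermform_tr hf) (lipR_tr lL) (delta_mx 0 j) (delta_mx 0 k).
  by rewrite !n2_delta_row !mul1r !mul_delta_mx /qf !trmx_delta.
pose al := complex.Re ((D 0 0)^* * D 0 0); pose be := complex.Re ((D 1 1)^* * D 1 1).
have n2D : n2 D = al + be.
  rewrite n2E !big_ord_recl !big_ord0 !e1 D01 D10 rmorph0 !mulr0 /=.
  by rewrite !addr0 add0r.
have n2_dd (i j : 'I_2) : n2 (delta_mx i j : 'M[C]_2) = 1.
  by rewrite -(mul_delta_mx (0 : 'I_1)) n2_delta n2_delta_row.
have cross : frob (delta_mx 0 0 : 'M[C]_2) (delta_mx 1 1) = 0.
  rewrite frobE; apply: big1 => i _; apply: big1 => j _; rewrite !mxE.
  by have [->|] := eqVneq i 0; rewrite ?mulr0 // rmorph0 mul0r.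
have n2vw (s t : R) : n2 (s%:C%C *: v + t%:C%C *: w) = s ^+ 2 * al + t ^+ 2 * be.
  rewrite (qfD hn) !(qfZ_real hn) !(qfZ _ _ hn) !n2_dd !mulr1 -/al -/be.
  by rewrite !(hermformZl hn, hermformZr hn) cross !mulr0 addr0.
have al0 : 0 <= al by rewrite /al Re_mulJ addr_ge0 ?sqr_ge0.
have be0 : 0 <= be by rewrite /be Re_mulJ addr_ge0 ?sqr_ge0.
have cs : (2 * complex.Re (f v w)) ^+ 2 <= al * be.
  apply: qf_cauchy_schwarz => // t s.
  (* [Z] fixes [v] and negates [w], so the change of the form is four times the cross term. *)
  pose Z : 'M[C]_2 := diag_mx (\row_i (-1) ^+ i).
  have hZ : Z \is unitarymx.
    apply/unitarymxP; rewrite tr_diag_mx map_diag_mx mulmx_diag.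
    rewrite -diag_const_mx; congr diag_mx; apply/rowP => i; rewrite !mxE.
    by rewrite rmorph_sign -signr_odd -signr_addb addbb.
  have := lL Z hZ (s%:C%C *: v + t%:C%C *: w); rewrite n2vw.
  have -> : Z *m (s%:C%C *: v + t%:C%C *: w) = s%:C%C *: v - t%:C%C *: w.
    have Zd (i j : 'I_2) : Z *m delta_mx i j = (-1) ^+ i *: delta_mx i j.
      rewrite mul_diag_mx; apply/matrixP => k l; rewrite !mxE.
      by have [->|] := eqVneq k i; rewrite ?mulr0.
    rewrite mulmxDr -!scalemxAr !Zd expr0 scale1r; congr (_ + _).
    by rewrite expr1 scaleN1r !scalerN.
  rewrite (qfD hf) (qfB hf); move: (qf f _) (qf f _) (complex.Re _) => x y z.
  by clear; lra.
rewrite DE (qfD hf) -DE !(qfZ _ _ hf) n2D sumE -/al -/be.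
have h1 := hj 0 0 1; have h2 := hj 0 1 0; have h3 := hj 1 0 1; have h4 := hj 1 1 0.
have g1 := hi 0 0 1; have g2 := hi 0 1 0; have g3 := hi 1 0 1; have g4 := hi 1 1 0.
move: (qf f _) (qf f _) (qf f _) (qf f _) h1 h2 h3 h4 g1 g2 g3 g4 => h00 h01 h10 h11.
have := @sqr_sqrtr R 2 (ler0n _ _); have := sqrtr_ge0 (2 : R).
move: cs; move: (complex.Re _) (Num.sqrt 2) => k s cs s0 s2 {hj hi n2D n2vw sumE}.
move=> h1 h2 h3 h4 g1 g2 g3 g4.
clear -cs s0 s2 al0 be0 h1 h2 h3 h4 g1 g2 g3 g4.
(* Here [p] and [c] are the values at the two basis vectors carrying the weights [a >= b], and [q],
   [r] those at the other two. *)
have arith (a b p q c r k' : R) : 0 <= b -> b <= a -> k' ^+ 2 <= a * b ->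
    p - q <= 1 -> p - r <= 1 -> q - c <= 1 -> c - q <= 1 -> c - r <= 1 ->
  a * p + b * c + k' <= ((p + q + (r + c)) / 4 + (1 + s) / 2) * (a + b).
  move=> b0 ba kk pq pr qc cq cr.
  have s1 : 1 <= s by nra.
  (* As [s ^+ 2 = 2], the factors [s - 1] and [1 + s] are mutually inverse: this is the
     arithmetic-geometric mean inequality. *)
  have kle : k' <= ((s - 1) * a + (1 + s) * b) / 2.
    have r0 : 0 <= ((s - 1) * a + (1 + s) * b) / 2 by nra.
    rewrite leNgt; apply/negP => lt; have := sqr_ge0 ((s - 1) * a - (1 + s) * b).
    nra.
  (* The weights are split into [a - b] and [b]: [p] exceeds the mean by at most 1, and [p + c]
     exceeds twice the mean by at most 1. *)
  have t1 : 0 <= (a - b) * (1 - (p - (p + q + (r + c)) / 4)).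
    by apply: mulr_ge0; lra.
  have t2 : 0 <= b * (1 - (p + c - (p + q + (r + c)) / 2)).
    by apply: mulr_ge0; lra.
  lra.
have [ba|ab] := leP be al.
  by apply: arith => //; lra.
rewrite [al * _ + _]addrC [al + be]addrC.
have -> : h11 + h10 + (h01 + h00) = h00 + h10 + (h01 + h11) by ring.
by apply: arith => //; [exact: ltW|rewrite [be * al]mulrC].
Qed.

Definition conjform m n (P : 'M[C]_m) (V : 'M[C]_n)
    (f : 'M[C]_(m, n) -> 'M[C]_(m, n) -> C) (M N : 'M[C]_(m, n)) : C :=
  f (P^t* *m M *m V^t*) (P^t* *m N *m V^t*).

Section Conjform.
Variables (m n : nat) (P : 'M[C]_m) (V : 'M[C]_n).
Variable f : 'M[C]_(m, n) -> 'M[C]_(m, n) -> C.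
Hypotheses (hP : P \is unitarymx) (hV : V \is unitarymx).

Let hP' : P^t* \is unitarymx. Proof. by rewrite trmxC_unitary. Qed.
Let hV' : V^t* \is unitarymx. Proof. by rewrite trmxC_unitary. Qed.

Lemma hermform_conj : hermform f -> hermform (conjform P V f).
Proof.
case=> lin sym; split=> [M a N N'|M N]; last exact: sym.
by rewrite /conjform mulmxDr mulmxDl -scalemxAr -scalemxAl lin.
Qed.

Lemma qf_conj M : qf (conjform P V f) (P *m M *m V) = qf f M.
Proof.
rewrite /qf /conjform !mulmxA (unitarymxVl hP) mul1mx.
by rewrite -mulmxA (unitarymxP hV) mulmx1.
Qed.

Lemma lipL_conj : lipL f -> lipL (conjform P V f).
Proof.
move=> lf U hU N.
have hU' := mul_unitarymx (mul_unitarymx hP' hU) hP.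
have := lf _ hU' (P^t* *m N *m V^t*).
rewrite (n2_mulr _ hV') (n2_mull _ hP').
suff -> : P^t* *m U *m P *m (P^t* *m N *m V^t*) = P^t* *m (U *m N) *m V^t* by [].
move: (unitarymxP hP); move: (P^t*) (V^t*) => P' V' PP.
by rewrite !mulmxA -(mulmxA _ P) PP mulmx1.
Qed.

Lemma lipR_conj : lipR f -> lipR (conjform P V f).
Proof.
move=> lf U hU N.
have hU' := mul_unitarymx (mul_unitarymx hV hU) hV'.
have := lf _ hU' (P^t* *m N *m V^t*).
rewrite (n2_mulr _ hV') (n2_mull _ hP').
suff -> : P^t* *m N *m V^t* *m (V *m U *m V^t*) = P^t* *m (N *m U) *m V^t* by [].
move: (unitarymxVl hV); move: (P^t*) (V^t*) => P' V' PP.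
by rewrite !mulmxA -(mulmxA _ V') PP mulmx1.
Qed.

Lemma sum_qf_delta_conj : hermform f ->
  \sum_i \sum_j qf (conjform P V f) (delta_mx i j) =
  \sum_i \sum_j qf f (delta_mx i j).
Proof.
move=> hf; rewrite -[RHS](sum_qf_delta_mulr hf hV').
have hR : hermform (fun M N : 'M[C]_(m, n) => f (M *m V^t*) (N *m V^t*)).
  exact: (hermform_comp hf (mulmxr (V^t*))).
exact: (sum_qf_delta_mull hR hP').
Qed.
End Conjform.

(** A singular value decomposition changes local bases, which preserves the hypotheses, the norm and
    the trace of the form, so [M] may be taken diagonal. *)
Lemma lip22_bound (f : 'M[C]_2 -> 'M[C]_2 -> C) M :
    hermform f -> lipL f -> lipR f ->
  qf f M <=
    ((\sum_i \sum_j qf f (delta_mx i j)) / 4 + (1 + Num.sqrt 2) / 2) * n2 M.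
Proof.
move=> hf lL lR; have [P [V [hP hV D01 D10]]] := svd22 M.
have := lip22_diag (hermform_conj P V hf) (lipL_conj hP hV lL)
  (lipR_conj hP hV lR) D01 D10.
by rewrite (n2_mulr _ hV) (n2_mull _ hP) (qf_conj f hP hV) (sum_qf_delta_conj hP hV hf).
Qed.

(** The bound is applied to [f] and to its opposite; the means cancel and the halves of the spread
    add up. *)
Lemma lip22_spread (f : 'M[C]_2 -> 'M[C]_2 -> C) :
    hermform f -> lipL f -> lipR f ->
  spread (qf f) n2 (1 + Num.sqrt 2).
Proof.
move=> hf lL lR M N; have B1 := lip22_bound M hf lL lR.
have := lip22_bound N (hermformN hf) (lipL_opp lL) (lipR_opp lR).
under eq_bigr do under eq_bigr do rewrite qf_opp.
rewrite qf_opp; under eq_bigr do rewrite sumrN.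
rewrite sumrN; move: B1; move: (n2_ge0 M) (n2_ge0 N).
move: (\sum_i _) (Num.sqrt 2) (n2 M) (n2 N) (qf f M) (qf f N) => S s nM nN qM qN.
clear=> M0 N0 B1 B2; have C1 := ler_wpM2l N0 B1; have C2 := ler_wpM2l M0 B2.
lra.
Qed.
End TwoQubits.

(** * Two copies *)

Section TwoCopies.
Context {R : rcfType}.
Local Notation C := R[i].
Local Notation n2 := (qf (@frob _ _ _)).

(* With [a], [b] the squared norms of the symmetric and antisymmetric parts of a
   vector on two copies, the right-hand side is a lower bound for its squared norm
   times its expected cost. *)
Definition gap_cond (D s : R) : Prop := forall a b : R, 0 <= a -> 0 <= b ->
  4 * s ^+ 2 * (a * b) <= (a + b) * ((2 * D - 4) * a + 2 * D * b).

Lemma gap_cond_le D D' s : D <= D' -> gap_cond D s -> gap_cond D' s.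
Proof.
move=> DD H a b a0 b0; apply: le_trans (H a b a0 b0) _.
have : 0 <= (D' - D) * (a + b) ^+ 2 by rewrite mulr_ge0 ?sqr_ge0 // subr_ge0.
nra.
Qed.

Lemma spread_le (V : lmodType C) (q n : V -> R) s s' :
  (forall v, 0 <= n v) -> s <= s' -> spread q n s -> spread q n s'.
Proof.
move=> n0 ss H v w; apply: le_trans (H v w) _.
by rewrite ler_wpM2r // mulr_ge0.
Qed.

(** Four cases: [s = 1] for [m = 1], [1 + sqrt 2] for two qubits, [5 / 2] for [m = 2] with [n] at
    least 3, and [3] beyond. By [gap_cond_le] only the least [D] of each case has to be checked. *)
Lemma lip_spread_gap_le m n (f : 'M[C]_(m, n) -> 'M[C]_(m, n) -> C) :
    (0 < m)%N -> (m <= n)%N -> hermform f -> lipL f -> lipR f ->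
  exists2 s, spread (qf f) n2 s & gap_cond (m + n)%:R s.
Proof.
case: m f => // -[|[|m]] f _ mn hf lL lR.
- exists 1.
    have -> : 1 = 3 - 4 / (2 ^+ 1 * 1%:R) :> R by field.
    exact: lip_spread.
  apply: (@gap_cond_le 2); first by rewrite ler_nat; case: n mn {f hf lL lR}.
  by move=> a b a0 b0; nra.
- case: n mn f hf lL lR => [|[|[|n]]] // _ f hf lL lR.
    (* The general value [5 / 2] violates the condition at [D = 4]; this one leaves exactly
       [4 (a - sqrt 2 b)^2]. *)
    exists (1 + Num.sqrt 2); first exact: lip22_spread.
    have := @sqr_sqrtr R 2 (ler0n _ _); move: (Num.sqrt 2) => r r2 a b a0 b0.
    have -> : (1 + r) ^+ 2 = 3 + 2 * r by lra.
    have := sqr_ge0 (a - r * b).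
    have -> : (a - r * b) ^+ 2 = a ^+ 2 - 2 * r * (a * b) + r ^+ 2 * b ^+ 2.
      by ring.
    by rewrite r2 -[(2 + 2)%N]/4%N; lra.
  exists (5 / 2).
    have -> : 5 / 2 = 3 - 4 / (2 ^+ 2 * 2%:R) :> R by field.
    exact: lip_spread.
  apply: (@gap_cond_le 5); first by rewrite ler_nat.
  by move=> a b a0 b0; have := sqr_ge0 (a - b); nra.
exists 3.
  apply: spread_le (lip_spread hf lL lR) => [v|]; first exact: n2_ge0.
  by rewrite gerBl divr_ge0 // mulr_ge0 // exprn_ge0.
apply: (@gap_cond_le 6).
  by rewrite ler_nat -[6%N]/(3 + 3)%N leq_add // (leq_trans _ mn).
by move=> a b a0 b0; have := sqr_ge0 (a - b); nra.
Qed.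

Lemma lip_spread_gap m n (f : 'M[C]_(m, n) -> 'M[C]_(m, n) -> C) :
    (0 < m)%N -> (0 < n)%N -> hermform f -> lipL f -> lipR f ->
  exists2 s, spread (qf f) n2 s & gap_cond (m + n)%:R s.
Proof.
move=> m0 n0 hf lL lR; case/orP: (leq_total m n) => le.
  exact: lip_spread_gap_le.
have [s sf gs] := lip_spread_gap_le n0 le (hermform_tr hf) (lipL_tr lR) (lipR_tr lL).
by exists s; rewrite 1?addnC //; exact: spread_tr.
Qed.

(* With [P] the coordinate matrix of a vector on two copies, the full swap is
   [P |-> P^T]. *)
Lemma spread_two_copies N (h : 'cV[C]_N -> 'cV[C]_N -> C) D s (Phi : 'M[C]_N) :
    hermform h -> spread (qf h) n2 s -> gap_cond D s ->
  (\sum_l qf h (col l Phi) - \sum_l qf h (col l Phi^T)) ^+ 2 <=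
    n2 Phi * ((2 * D - 2) * n2 Phi - 2 * complex.Re (frob Phi Phi^T)).
Proof.
move=> hh sh gD.
(* If [h] is the form of [H], then [F] is that of [H] acting on the first copy; evaluating at
   transposes gives the second copy. *)
pose F (A B : 'M[C]_N) : C := \sum_l h (col l A) (col l B).
have hF : hermform F.
  split=> [M a A B|A B].
    rewrite /F mulr_sumr -big_split; apply: eq_bigr => l _ /=.
    by rewrite linearP /= (hermformDr hh) (hermformZr hh).
  by rewrite /F rmorph_sum; apply: eq_bigr => l _; exact: hh.2.
have qFE A : qf F A = \sum_l qf h (col l A) by rewrite /qf Re_sum.
rewrite -!qFE; have hn := @hermform_frob R N N.
have n2c (A : 'M[C]_N) : n2 A = \sum_l n2 (col l A).
  by rewrite -n2_tr n2_rows; apply: eq_bigr => l _; rewrite -tr_col n2_tr.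
(* Every column of [A] is compared with every column of [A^T]; both families have total squared norm
   [n2 A]. *)
have Gs A : qf F A - qf F A^T <= s * n2 A.
  have [A0|A0] := eqVneq (n2 A) 0.
    by rewrite (n2_eq0 A0) trmx0 subrr (qf0 hn) mulr0.
  have Ap : 0 < n2 A by rewrite lt_neqAle eq_sym A0 n2_ge0.
  rewrite -(ler_pM2l Ap) mulrBr mulrCA -{1 4}(n2_tr A) !qFE.
  rewrite (n2c A) (n2c A^T).
  by apply: spread_sum => i j; exact: sh.
(* The symmetric and antisymmetric parts, eigenvectors of the full swap for [1] and [-1]. *)
pose a : 'M[C]_N := (1 / 2 : R)%:C%C *: (Phi + Phi^T).
pose b : 'M[C]_N := (1 / 2 : R)%:C%C *: (Phi - Phi^T).
have aT : a^T = a by rewrite linearZ linearD /= trmxK addrC.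
have bT : b^T = - b by rewrite linearZ linearB /= trmxK -scalerN opprB.
have half (A : 'M[C]_N) : (1 / 2 : R)%:C%C *: (A + A) = A.
  rewrite -mulr2n -scaler_nat scalerA -(rmorph_nat (real_complex R)) -rmorphM.
  by rewrite divfK ?pnatr_eq0 // rmorph1 scale1r.
have abP : a + b = Phi.
  by rewrite /a /b -scalerDr addrACA subrr addr0 half.
have abT : a - b = Phi^T by rewrite -abP linearD /= aT bT.
clearbody a b.
have fab : complex.Re (frob a b) = 0.
  have : n2 (a + b) = n2 (a - b) by rewrite abP abT n2_tr.
  rewrite (qfD hn) (qfB hn); move: (n2 a) (n2 b) (complex.Re _) => x y z.
  by clear; lra.
have a0 := n2_ge0 a; have b0 := n2_ge0 b.
have n2P : n2 Phi = n2 a + n2 b.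
  by rewrite -{1}abP (qfD hn) fab mulr0 addr0.
have frP : complex.Re (frob Phi Phi^T) = n2 a - n2 b.
  have := qfB hn Phi Phi^T; have -> : Phi - Phi^T = b + b.
    by rewrite -abT -abP opprB [a + b]addrC addrACA subrr addr0.
  rewrite (qfD hn) -/(qf (@frob _ _ _) b) n2_tr n2P.
  by move: (complex.Re _) (n2 a) (n2 b) => x y z; clear; lra.
have GP : qf F Phi - qf F Phi^T = 4 * complex.Re (F a b).
  rewrite -abT -{1}abP (qfD hF) (qfB hF).
  by move: (qf F a) (qf F b) (complex.Re _) => x y z; clear; lra.
have [P0|P0] := eqVneq (n2 Phi) 0.
  by rewrite P0 (n2_eq0 P0) trmx0 subrr expr0n mul0r.
have sp : 0 <= s.
  have := Gs Phi; have := Gs Phi^T; rewrite trmxK n2_tr => G1 G2.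
  have : 0 <= s * n2 Phi.
    by move: G1 G2; move: (qf F _) (qf F _) (s * _) => x y z; clear; lra.
  by rewrite pmulr_lge0 // lt_neqAle eq_sym P0 n2_ge0.
(* Transposition negates [b] only, so [Gs] at a real combination of [a] and [b] isolates their cross
   term. *)
have cs : (2 * complex.Re (F a b)) ^+ 2 <= (s * n2 a) * (s * n2 b).
  apply: (qf_cauchy_schwarz hF); rewrite ?mulr_ge0 // => t u.
  have := Gs (u%:C%C *: a + t%:C%C *: b).
  rewrite [_^T]linearD /= !linearZ /= aT bT scalerN (qfD hF) (qfB hF) (qfD hn).
  rewrite (hermformZl hn) (hermformZr hn) conj_real !Re_realM fab !(qfZ_real hn).
  move: (qf F _) (qf F _) (complex.Re _) (n2 a) (n2 b) => x y z v w.
  by clear; lra.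
have := gD _ _ a0 b0; rewrite GP n2P frP; move: cs.
move: (complex.Re _) (n2 a) (n2 b) => x y z; clear; nra.
Qed.
End TwoCopies.

(** * The Lipschitz seminorm *)

Section Vectorization.
Context {R : realType}.
Local Notation C := R[i].
Local Notation n2 := (qf (@frob _ _ _)).

(* A vector of the tensor product is handled as the matrix [M] of its
   coordinates; [A *t B] then acts by [M |-> A *m M *m B^T]. *)
Definition tvec m n (M : 'M[C]_(m, n)) : 'cV[C]_(m * n) :=
  \col_k M (mxtens_unindex k).1 (mxtens_unindex k).2.

Lemma tvec_linear m n : linear (@tvec m n).
Proof. by move=> a M N; apply/colP => k; rewrite !mxE. Qed.

HB.instance Definition _ m n := GRing.isLinear.Build C _ _ _ (@tvec m n)
  (@tvec_linear m n).

Lemma tvec_onto m n (v : 'cV[C]_(m * n)) : exists M, v = tvec M.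
Proof.
exists (\matrix_(i, j) v (mxtens_index (i, j)) 0).
by apply/colP => k; rewrite !mxE -surjective_pairing mxtens_unindexK.
Qed.

Lemma tvecE m n (M : 'M[C]_(m, n)) i j : tvec M (mxtens_index (i, j)) 0 = M i j.
Proof. by rewrite mxE mxtens_indexK. Qed.

Lemma sum_mxtens (V : nmodType) m n (F : 'I_(m * n) -> V) :
  \sum_k F k = \sum_i \sum_j F (mxtens_index (i, j)).
Proof.
rewrite pair_bigA /= (reindex (@mxtens_index m n)) /=.
  by apply: eq_bigr => -[i j].
by exists (@mxtens_unindex m n) => k _; rewrite (mxtens_indexK, mxtens_unindexK).
Qed.

Lemma tensmx_tvec m n (A : 'M[C]_m) (B : 'M[C]_n) M :
  (A *t B) *m tvec M = tvec (A *m M *m B^T).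
Proof.
apply/colP => k; case: (mxtens_indexP k) => i j; rewrite mxE sum_mxtens.
rewrite !mxE mxtens_indexK /= exchange_big; apply: eq_bigr => l _ /=.
rewrite !mxE mulr_suml; apply: eq_bigr => p _.
by rewrite tensmxE !mxE mxtens_indexK /= mulrAC.
Qed.

Lemma frob_tvec m n (M N : 'M[C]_(m, n)) : frob (tvec M) (tvec N) = frob M N.
Proof.
rewrite !frobE sum_mxtens; apply: eq_bigr => i _; apply: eq_bigr => j _.
by rewrite big_ord1 !mxE mxtens_indexK.
Qed.

Lemma n2_tvec m n (M : 'M[C]_(m, n)) : n2 (tvec M) = n2 M.
Proof. by rewrite /qf frob_tvec. Qed.

Definition opform N (H : 'M[C]_N) (v w : 'cV[C]_N) : C := frob v (H *m w).

Lemma hermform_op N (H : 'M[C]_N) : H \is hermsymmx -> hermform (opform H).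
Proof.
move=> /is_hermitianmxP; rewrite expr0 scale1r => hH.
have hn := @hermform_frob R N 1.
split=> [v a w w'|v w]; rewrite /opform.
  by rewrite mulmxDr -scalemxAr (hermformDr hn) (hermformZr hn).
by rewrite -(hn.2 v) /frob adjM -hH mulmxA.
Qed.

Lemma unitarymx1 n : (1%:M : 'M[C]_n) \is unitarymx.
Proof. by apply/unitarymxP; rewrite trmx1 map_mx1 mulmx1. Qed.

Lemma unitarymx_tens m n (A : 'M[C]_m) (B : 'M[C]_n) :
  A \is unitarymx -> B \is unitarymx -> A *t B \is unitarymx.
Proof.
move=> /unitarymxP hA /unitarymxP hB; apply/unitarymxP.
rewrite trmx_tens.
have -> : map_mx Num.conj (A^T *t B^T) = A^t* *t B^t*.
  by apply/matrixP => i j; rewrite !mxE rmorphM.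
rewrite tensmx_mul hA hB; apply/matrixP => i j.
case: (mxtens_indexP i) => i1 i2; case: (mxtens_indexP j) => j1 j2.
rewrite tensmxE !mxE -natrM mulnb; congr (_%:R); congr nat_of_bool.
by rewrite (can_eq (@mxtens_indexK m n)) xpair_eqE.
Qed.

Lemma vnormE n (v : 'cV[C]_n) : vnorm v = Num.sqrt (n2 v).
Proof. by rewrite /vnorm /qf /frob /adjmx /mxtrace big_ord1. Qed.

Lemma opnorm_unitary n (U : 'M[C]_n) : U \is unitarymx -> (opnorm U <= 1)%E.
Proof.
move=> hU; apply: ge_ereal_sup => _ [v /= v1 <-].
by rewrite lee_fin vnormE (n2_mull _ hU) -vnormE.
Qed.

Lemma n2_opnorm n (A : 'M[C]_n) (v : 'cV[C]_n) : (opnorm A <= 1)%E -> n2 (A *m v) <= n2 v.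
Proof.
move=> hA; have hn := @hermform_frob R n 1.
have [v0|v0] := eqVneq (n2 v) 0.
  by rewrite (n2_eq0 v0) mulmx0.
have vp : 0 < n2 v by rewrite lt_neqAle eq_sym v0 n2_ge0.
pose r := (Num.sqrt (n2 v))^-1.
have r2 : r ^+ 2 = (n2 v)^-1 by rewrite exprVn sqr_sqrtr // n2_ge0.
have : ((vnorm (A *m (r%:C%C *: v)))%:E <= 1)%E.
  apply: le_trans hA; apply: ereal_sup_ubound; exists (r%:C%C *: v) => //=.
  by rewrite vnormE (qfZ_real hn) r2 mulVf // sqrtr1.
rewrite lee_fin vnormE -scalemxAr (qfZ_real hn) r2 -[X in _ <= X -> _]sqrtr1 ler_sqrt ?ltr01 //.
by rewrite mulrC ler_pdivrMr // mul1r.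
Qed.

(** The difference is the real part of [<W v, [W, H] v>], an inner product of two vectors no longer
    than [v]. *)
Lemma opform_conj_le N (H W : 'M[C]_N) (v : 'cV[C]_N) : W \is unitarymx ->
    (opnorm (commmx W H) <= 1)%E ->
  qf (opform H) v - qf (opform H) (W *m v) <= n2 v.
Proof.
move=> hW hK; have hn := @hermform_frob R N 1.
have WH : frob (W *m v) (W *m (H *m v)) = frob v (H *m v).
  by rewrite /frob adjM -!mulmxA [W^t* *m _]mulmxA (unitarymxVl hW) mul1mx.
have E : frob (W *m v) (commmx W H *m v) = opform H v v - opform H (W *m v) (W *m v).
  by rewrite /commmx mulmxBl -!mulmxA (hermformDr hn) (hermformNr hn) WH.
have -> : qf (opform H) v - qf (opform H) (W *m v) =
    complex.Re (frob (W *m v) (commmx W H *m v)) by rewrite E Re_add Re_opp.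
have := n2_ge0 (W *m v - commmx W H *m v).
rewrite (qfB hn) (n2_mull _ hW); have := n2_opnorm v hK.
by move: (complex.Re _) (n2 _) (n2 _) => x y z; clear; lra.
Qed.

Definition tform m n (H : 'M[C]_(m * n)) (M N : 'M[C]_(m, n)) : C :=
  opform H (tvec M) (tvec N).

Lemma lipnorm_lip m n (H : 'M[C]_(m * n)) : (lipnorm H <= 1)%E ->
  lipL (tform H) /\ lipR (tform H).
Proof.
rewrite /lipnorm ge_max => /andP[hA hB]; split=> U hU M.
  have hW := unitarymx_tens hU (unitarymx1 n).
  have := @opform_conj_le _ H _ (tvec M) hW; rewrite tensmx_tvec trmx1 mulmx1 n2_tvec.
  apply; apply: le_trans hA; apply: ereal_sup_ubound; exists U => //=.
  exact: opnorm_unitary.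
(* The operator [1%:M *t B] multiplies coordinate matrices on the right by [B^T], hence the choice
   [B = U^T]. *)
have hUT : U^T \is unitarymx by rewrite trmx_unitary.
have hW := unitarymx_tens (unitarymx1 m) hUT.
have := @opform_conj_le _ H _ (tvec M) hW; rewrite tensmx_tvec trmxK mul1mx n2_tvec.
apply; apply: le_trans hB; apply: ereal_sup_ubound; exists U^T => //=.
exact: opnorm_unitary.
Qed.

Lemma lipnorm_spread m n (H : 'M[C]_(m * n)) :
    (0 < m)%N -> (0 < n)%N -> H \is hermsymmx -> (lipnorm H <= 1)%E ->
  exists2 s, spread (qf (opform H)) n2 s & gap_cond (m + n)%:R s.
Proof.
move=> m0 n0 hH /lipnorm_lip [lL lR].
have hf : hermform (tform H) := hermform_comp (hermform_op hH) (@tvec m n).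
have [s sf gs] := lip_spread_gap m0 n0 hf lL lR; exists s => // v w.
have [M ->] := tvec_onto v; have [N ->] := tvec_onto w.
by rewrite !n2_tvec; exact: sf.
Qed.
End Vectorization.

(** * The cost operator *)

Section Swaps.
Context {R : realType}.
Local Notation C := R[i].
Local Notation n2 := (qf (@frob _ _ _)).

Definition permv K (s : 'I_K -> 'I_K) (v : 'cV[C]_K) : 'cV[C]_K :=
  \col_i v (s i) 0.

Definition funmx K (s : 'I_K -> 'I_K) : 'M[C]_K := \matrix_(i, j) (j == s i)%:R.

Lemma mul_funmx K (s : 'I_K -> 'I_K) v : funmx s *m v = permv s v.
Proof.
apply/colP => i; rewrite !mxE (bigD1 (s i)) //= big1 => [|j ji].
  by rewrite mxE eqxx mul1r addr0.
by rewrite mxE (negPf ji) mul0r.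
Qed.

Lemma frob_permv K (s : 'I_K -> 'I_K) v w : involutive s ->
  frob (permv s v) w = frob v (permv s w).
Proof.
move=> sK; rewrite !frobE (reindex_inj (inv_inj sK)); apply: eq_bigr => i _.
by rewrite !big_ord1 !mxE sK.
Qed.

Lemma permvB K (s : 'I_K -> 'I_K) v w : permv s (v - w) = permv s v - permv s w.
Proof. by apply/colP => i; rewrite !mxE. Qed.

Lemma permv_comp K (s t : 'I_K -> 'I_K) v :
  permv s (permv t v) = permv (t \o s) v.
Proof. by apply/colP => i; rewrite !mxE. Qed.

Lemma permvK K (s : 'I_K -> 'I_K) v : involutive s -> permv s (permv s v) = v.
Proof. by move=> sK; apply/colP => i; rewrite !mxE sK. Qed.

(* This is [(1 - S) (1 - T) >= 0]. *)
Lemma commuting_involutions (V : lmodType C) (h : V -> V -> C) (S T : V -> V) v :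
    hermform h -> (forall w, 0 <= qf h w) ->
    (forall w w', S (w - w') = S w - S w') ->
    (forall w w', h (S w) w' = h w (S w')) ->
    (forall w w', h (T w) w' = h w (T w')) ->
    (forall w, S (S w) = w) -> (forall w, T (T w) = w) ->
    (forall w, T (S w) = S (T w)) ->
  complex.Re (h v (S v)) + complex.Re (h v (T v)) <=
  qf h v + complex.Re (h v (S (T v))).
Proof.
(* The squared length of [(1 - S) (1 - T) v] is four times the form of [(1 - S) (1 - T)] at [v]. *)
move=> hh h0 SB Sh Th SK TK TS; have := h0 (v - T v - S (v - T v)).
have qS w : qf h (S w) = qf h w by rewrite /qf Sh SK.
have qT w : qf h (T w) = qf h w by rewrite /qf Th TK.
rewrite (qfB hh) qS (qfB hh) qT SB.
rewrite !(hermformDr hh) !(hermformDl hh) !(hermformNr hh) !(hermformNl hh) !Th TS TS TK.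
rewrite !(Re_add, Re_opp).
move: (qf h v) (complex.Re _) (complex.Re _) (complex.Re _) => x y z w.
by clear; lra.
Qed.

Lemma permv_ineq K (s t : 'I_K -> 'I_K) v :
    involutive s -> involutive t -> s \o t =1 t \o s ->
  complex.Re (frob v (permv s v)) + complex.Re (frob v (permv t v)) <=
  n2 v + complex.Re (frob v (permv (s \o t) v)).
Proof.
move=> sK tK st.
have -> : permv (s \o t) v = permv s (permv t v).
  by rewrite permv_comp; apply/colP => i; rewrite !mxE st.
apply: (commuting_involutions v (hermform_frob K 1)) => [w|w w'|w w'|w w'|w|w|w].
- exact: n2_ge0.
- exact: permvB.
- exact: frob_permv.
- exact: frob_permv.
- exact: permvK.
- exact: permvK.
by rewrite !permv_comp; apply/colP => i; rewrite !mxE st.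
Qed.

Section Pair.
Variables (m n : nat).
Local Notation idx := mxtens_index.
Local Notation K := ((m * n) * (m * n))%N.

(** The index permutation underlying the swap S_A; [swapR] is the one for S_B. *)
Definition swapL (x : 'I_K) : 'I_K :=
  let p := mxtens_unindex (mxtens_unindex x).1 in
  let q := mxtens_unindex (mxtens_unindex x).2 in
  idx (idx (q.1, p.2), idx (p.1, q.2)).

Definition swapR (x : 'I_K) : 'I_K :=
  let p := mxtens_unindex (mxtens_unindex x).1 in
  let q := mxtens_unindex (mxtens_unindex x).2 in
  idx (idx (p.1, q.2), idx (q.1, p.2)).

Lemma swapLE a b c d :
  swapL (idx (idx (a, b), idx (c, d))) = idx (idx (c, b), idx (a, d)).
Proof. by rewrite /swapL !mxtens_indexK. Qed.

Lemma swapRE a b c d :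
  swapR (idx (idx (a, b), idx (c, d))) = idx (idx (a, d), idx (c, b)).
Proof. by rewrite /swapR !mxtens_indexK. Qed.

Lemma swapLK : involutive swapL.
Proof.
move=> x; case: (mxtens_indexP x) => p q.
by case: (mxtens_indexP p) => a b; case: (mxtens_indexP q) => c d; rewrite !swapLE.
Qed.

Lemma swapRK : involutive swapR.
Proof.
move=> x; case: (mxtens_indexP x) => p q.
by case: (mxtens_indexP p) => a b; case: (mxtens_indexP q) => c d; rewrite !swapRE.
Qed.

Lemma swapLR : swapL \o swapR =1 swapR \o swapL.
Proof.
move=> x; case: (mxtens_indexP x) => p q.
case: (mxtens_indexP p) => a b; case: (mxtens_indexP q) => c d /=.
by rewrite !(swapLE, swapRE).
Qed.

Lemma permv_swapLR (M : 'M[C]_(m * n)) : permv (swapL \o swapR) (tvec M) = tvec M^T.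
Proof.
apply/colP => x; rewrite [LHS]mxE /=; case: (mxtens_indexP x) => p q.
case: (mxtens_indexP p) => a b; case: (mxtens_indexP q) => c d.
by rewrite swapRE swapLE !tvecE [RHS]mxE.
Qed.
End Pair.

Lemma trace_mulC_sum d (A B : 'M[C]_d) :
  \tr (A *m B) = \sum_a \sum_b A a b * B b a.
Proof. by rewrite /mxtrace; apply: eq_bigr => a _; rewrite mxE. Qed.

(** Needed because [1 + (d ^ 2 - 1)] and [d * d] are equal only by a proof. *)
Lemma mulmx1C_eq p q (A : 'M[C]_(p, q)) (B : 'M[C]_(q, p)) :
  p = q -> A *m B = 1%:M -> B *m A = 1%:M.
Proof. by move=> e; case: _ / e in B A *; exact: mulmx1C. Qed.

(* The [F i] and [1 / sqrt d] are the rows of a square matrix [V] with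
   [V *m V^t* = 1%:M], hence [V^t* *m V = 1%:M]. *)
Lemma onb_complete d (F : 'I_(d ^ 2 - 1) -> 'M[C]_d) : (0 < d)%N ->
    traceless_onb F -> forall a b c e,
  \sum_i F i a b * F i c e =
    ((a == e) && (b == c))%:R - ((a == b) && (c == e))%:R / d%:R.
Proof.
move=> d0 [herm tr0 orth _] a b c e.
have hermE i x y : F i x y = (F i y x)^*.
  have := herm i; move=> /is_hermitianmxP; rewrite expr0 scale1r => E.
  by rewrite {1}E !mxE.
pose r : C := (Num.sqrt (d%:R : R))^-1%:C%C.
have rr : r * r = d%:R^-1.
  rewrite -rmorphM -invfM -expr2 sqr_sqrtr ?ler0n // fmorphV.
  by rewrite rmorph_nat.
have rJ : r^* = r by rewrite conj_real.
pose V0 : 'rV[C]_(d * d) :=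
  \row_k (r * ((mxtens_unindex k).1 == (mxtens_unindex k).2)%:R).
pose V1 : 'M[C]_(d ^ 2 - 1, d * d) :=
  \matrix_(i, k) F i (mxtens_unindex k).1 (mxtens_unindex k).2.
pose V := col_mx V0 V1.
have VV : V *m V^t* = 1%:M.
  rewrite tr_col_mx map_row_mx mul_col_row scalar_mx_block; congr block_mx.
  - apply/matrixP => i j; rewrite !ord1 !mxE sum_mxtens.
    transitivity (\sum_(x < d) (d%:R^-1 : C)); last first.
      by rewrite sumr_const card_ord -[LHS]mulr_natl divff // pnatr_eq0 -lt0n.
    apply: eq_bigr => x _.
    rewrite (bigD1 x) //= big1 => [|y yx]; rewrite !mxE mxtens_indexK /=.
      by rewrite eqxx mulr1 rJ rr addr0.
    by rewrite eq_sym (negPf yx) mulr0 mul0r.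
  - apply/matrixP => i j; rewrite !mxE sum_mxtens.
    transitivity (r * (\tr (F j))^*); last by rewrite tr0 rmorph0 mulr0.
    rewrite /mxtrace rmorph_sum mulr_sumr; apply: eq_bigr => x _.
    rewrite (bigD1 x) //= big1 => [|y yx]; rewrite !mxE mxtens_indexK /=.
      by rewrite eqxx mulr1 addr0.
    by rewrite eq_sym (negPf yx) mulr0 mul0r.
  - apply/matrixP => i j; rewrite !mxE sum_mxtens.
    transitivity (r * \tr (F i)); last by rewrite tr0 mulr0.
    rewrite /mxtrace mulr_sumr; apply: eq_bigr => x _.
    rewrite (bigD1 x) //= big1 => [|y yx]; rewrite !mxE mxtens_indexK /=.
      by rewrite eqxx mulr1 addr0 rJ mulrC.
    by rewrite eq_sym (negPf yx) mulr0 rmorph0 mulr0.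
  apply/matrixP => i j; rewrite !mxE -orth trace_mulC_sum sum_mxtens.
  apply: eq_bigr => x _; apply: eq_bigr => y _.
  by rewrite !mxE mxtens_indexK /= -hermE.
(* The truncated subtraction is exact since [d] is positive. *)
have sz : (1 + (d ^ 2 - 1) = d * d)%N.
  by rewrite addnC subnK ?expn_gt0 ?d0 // mulnn.
have := mulmx1C_eq sz VV.
(* As [F i] is Hermitian, the conjugate of [F i b a] is [F i a b], so this entry is the wanted sum
   plus the contribution of the constant row. *)
move=> /matrixP /(_ (mxtens_index (b, a)) (mxtens_index (c, e))).
rewrite tr_col_mx map_row_mx mul_row_col !mxE big_ord1 !mxE !mxtens_indexK /=.
rewrite (can_eq (@mxtens_indexK d d)) xpair_eqE.
under eq_bigr => i _ do rewrite !mxE !mxtens_indexK /= -hermE.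
rewrite [X in _ -> _ = X]addrC andbC => <-.
have -> : (r * (b == a)%:R)^* * (r * (c == e)%:R) =
    ((a == b) && (c == e))%:R / d%:R.
  by rewrite rmorphM rmorph_nat /= rJ mulrACA rr -natrM mulnb eq_sym mulrC.
by rewrite addrA addNr add0r.
Qed.
End Swaps.

(** * The cost operator in terms of the partial swaps *)

Section Cost.
Context {R : realType}.
Local Notation C := R[i].
Local Notation n2 := (qf (@frob _ _ _)).

Lemma tens_scalar m n (c : C) : (c%:M : 'M[C]_m) *t (1%:M : 'M[C]_n) = c%:M.
Proof.
apply/matrixP => x y; case: (mxtens_indexP x) => a b; case: (mxtens_indexP y) => a' b'.
rewrite tensmxE !mxE (can_eq (@mxtens_indexK m n)) xpair_eqE.
by case: (a == a'); case: (b == b'); rewrite ?mulr1n ?mulr0n ?mulr0 ?mul0r ?mulr1.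
Qed.

Lemma tens_scalar_r m n (c : C) : (1%:M : 'M[C]_m) *t (c%:M : 'M[C]_n) = c%:M.
Proof.
apply/matrixP => x y; case: (mxtens_indexP x) => a b; case: (mxtens_indexP y) => a' b'.
rewrite tensmxE !mxE (can_eq (@mxtens_indexK m n)) xpair_eqE.
by case: (a == a'); case: (b == b'); rewrite ?mulr1n ?mulr0n ?mulr0 ?mul0r ?mul1r.
Qed.

Lemma tens_suml I (r : seq I) m n p q (F : I -> 'M[C]_(m, n)) (B : 'M[C]_(p, q)) :
  \sum_(i <- r) F i *t B = (\sum_(i <- r) F i) *t B.
Proof.
apply/matrixP => x y; rewrite summxE !mxE summxE mulr_suml.
by apply: eq_bigr => i _; rewrite mxE.
Qed.

Lemma tens_sumr I (r : seq I) m n p q (F : I -> 'M[C]_(p, q)) (B : 'M[C]_(m, n)) :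
  \sum_(i <- r) B *t F i = B *t (\sum_(i <- r) F i).
Proof.
apply/matrixP => x y; rewrite summxE !mxE summxE mulr_sumr.
by apply: eq_bigr => i _; rewrite mxE.
Qed.

Lemma sqr_tens_diff N (X : 'M[C]_N) :
  (X *t (1%:M : 'M[C]_N) - (1%:M : 'M[C]_N) *t X) ^+ 2 =
  (X *m X) *t 1%:M + 1%:M *t (X *m X) - (X *t X) *+ 2.
Proof.
rewrite expr2 -[_ * _]/(_ *m _) mulmxBr !mulmxBl !tensmx_mul !mulmx1 !mul1mx.
by rewrite mulr2n opprB addrACA -opprD.
Qed.

(** Used with [c = d - 1 / d] and [e = 1 / d], so that the scalar becomes [2 d]; [S] will be a
    partial swap. *)
Lemma sum_sqr_tens_diff (I : finType) N (X : I -> 'M[C]_N) (c e : C) S :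
    \sum_i X i *m X i = c%:M -> \sum_i X i *t X i = S - e%:M ->
  \sum_i (X i *t (1%:M : 'M[C]_N) - (1%:M : 'M[C]_N) *t X i) ^+ 2 =
  (2 * (c + e))%:M - S *+ 2.
Proof.
move=> XX XtX; under eq_bigr do rewrite sqr_tens_diff.
rewrite sumrB big_split /= tens_suml tens_sumr XX tens_scalar tens_scalar_r.
under [X in _ - X]eq_bigr do rewrite mulr2n.
have -> : (2 * (c + e))%:M = c%:M + c%:M + (e%:M + e%:M) :> 'M[C]_(N * N).
  by rewrite mulr_natl raddfMn raddfD mulr2n addrACA.
by rewrite big_split /= XtX [X in _ - X]addrACA -opprD opprB addrA mulr2n.
Qed.

Section OneSide.
Variables (d : nat) (F : 'I_(d ^ 2 - 1) -> 'M[C]_d).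
Hypotheses (d0 : (0 < d)%N) (hF : traceless_onb F).

(** The completeness relation contracted over its two inner indices. *)
Lemma onb_sum_sqr : \sum_i F i *m F i = (d%:R - d%:R^-1)%:M.
Proof.
apply/matrixP => a b; rewrite summxE.
under eq_bigr do rewrite mxE.
rewrite exchange_big /=; under eq_bigr do rewrite (onb_complete d0 hF).
rewrite sumrB mxE [X in _ - X](bigD1 a) //= [X in _ - (_ + X)]big1 => [|k ka].
  under eq_bigr do rewrite eqxx andbT.
  rewrite sumr_const card_ord eqxx /= addr0 mulrnBl -[(a == b)%:R *+ d]mulr_natr.
  by case: (a == b); rewrite ?mul1r ?mulr1n ?mul0r ?mulr0n ?subrr.
by rewrite eq_sym (negPf ka) mul0r.
Qed.
End OneSide.

Variables (m n : nat).
Variables (FA : 'I_(m ^ 2 - 1) -> 'M[C]_m) (FB : 'I_(n ^ 2 - 1) -> 'M[C]_n).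
Hypotheses (m0 : (0 < m)%N) (n0 : (0 < n)%N).
Hypotheses (hA : traceless_onb FA) (hB : traceless_onb FB).
Local Notation idx := mxtens_index.

(** In the completeness relation the first term is the swap of the first factors, and the second is
    a multiple of the identity. *)
Lemma sum_tens_swapL :
  \sum_i (FA i *t (1%:M : 'M[C]_n)) *t (FA i *t (1%:M : 'M[C]_n)) =
  funmx (@swapL m n) - (m%:R^-1)%:M.
Proof.
apply/matrixP => x y; rewrite summxE.
case: (mxtens_indexP x) => p q; case: (mxtens_indexP y) => p' q'.
case: (mxtens_indexP p) => a b; case: (mxtens_indexP q) => c d.
case: (mxtens_indexP p') => a' b'; case: (mxtens_indexP q') => c' d'.
under eq_bigr do rewrite !tensmxE [_%:M b b']mxE [_%:M d d']mxE mulrACA.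
rewrite -mulr_suml (onb_complete m0 hA) !mxE swapLE.
rewrite !(can_eq (@mxtens_indexK _ _)) !xpair_eqE !(can_eq (@mxtens_indexK _ _)) !xpair_eqE.
rewrite [a' == c]eq_sym [b' == b]eq_sym [c' == a]eq_sym [d' == d]eq_sym.
case: (a == c'); case: (c == a'); case: (b == b'); case: (d == d');
case: (a == a'); case: (c == c') => /=;
by rewrite ?(mulr1n, mulr0n, mulr1, mulr0, mul1r, mul0r, oppr0, addr0, add0r, subrr).
Qed.

Lemma sum_tens_swapR :
  \sum_i ((1%:M : 'M[C]_m) *t FB i) *t ((1%:M : 'M[C]_m) *t FB i) =
  funmx (@swapR m n) - (n%:R^-1)%:M.
Proof.
apply/matrixP => x y; rewrite summxE.
case: (mxtens_indexP x) => p q; case: (mxtens_indexP y) => p' q'.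
case: (mxtens_indexP p) => a b; case: (mxtens_indexP q) => c d.
case: (mxtens_indexP p') => a' b'; case: (mxtens_indexP q') => c' d'.
under eq_bigr do rewrite !tensmxE [_%:M a a']mxE [_%:M c c']mxE mulrACA.
rewrite -mulr_sumr (onb_complete n0 hB) !mxE swapRE.
rewrite !(can_eq (@mxtens_indexK _ _)) !xpair_eqE !(can_eq (@mxtens_indexK _ _)) !xpair_eqE.
rewrite [b' == d]eq_sym [a' == a]eq_sym [d' == b]eq_sym [c' == c]eq_sym.
case: (b == d'); case: (d == b'); case: (a == a'); case: (c == c');
case: (b == b'); case: (d == d') => /=;
by rewrite ?(mulr1n, mulr0n, mulr1, mulr0, mul1r, mul0r, oppr0, addr0, add0r, subrr).
Qed.

Lemma cost_swap :
  cost FA FB = (2 * (m + n)%:R)%:M - (funmx (@swapL m n)) *+ 2 - (funmx (@swapR m n)) *+ 2.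
Proof.
have sA : \sum_i (FA i *t (1%:M : 'M[C]_n)) *m (FA i *t (1%:M : 'M[C]_n)) =
    (m%:R - m%:R^-1)%:M.
  under eq_bigr do rewrite tensmx_mul mulmx1.
  by rewrite tens_suml (onb_sum_sqr m0 hA) tens_scalar.
have sB : \sum_i ((1%:M : 'M[C]_m) *t FB i) *m ((1%:M : 'M[C]_m) *t FB i) =
    (n%:R - n%:R^-1)%:M.
  under eq_bigr do rewrite tensmx_mul mulmx1.
  by rewrite tens_sumr (onb_sum_sqr n0 hB) tens_scalar_r.
rewrite /cost /cost_family big_cat !big_map /=.
rewrite -![Finite.enum _]/(index_enum _).
rewrite (sum_sqr_tens_diff sA sum_tens_swapL) (sum_sqr_tens_diff sB sum_tens_swapR).
by rewrite !subrK addrACA -raddfD /= -mulrDr -natrD addrA.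
Qed.

(** In [cost_swap], S_A + S_B is replaced by the larger 1 + S_A S_B, whose product acts as
    transposition. *)
Lemma cost_ge (P : 'M[C]_(m * n)) :
  (2 * (m + n)%:R - 2) * n2 P - 2 * complex.Re (frob P P^T) <=
  complex.Re (frob (tvec P) (cost FA FB *m tvec P)).
Proof.
have aux (x y z w D : R) : y + z <= w + x ->
    (D - 2) * w - 2 * x <= D * w - (y + y) - (z + z) by lra.
have hn := @hermform_frob R (m * n * (m * n)) 1.
have := permv_ineq (tvec P) (@swapLK m n) (@swapRK m n) (@swapLR m n).
rewrite permv_swapLR frob_tvec n2_tvec.
rewrite cost_swap ![funmx _ *+ 2]mulr2n !mulmxBl !mulmxDl !mul_funmx mul_scalar_mx.
have -> : (2 * (m + n)%:R : C) = (2 * (m + n)%:R : R)%:C%C.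
  by rewrite rmorphM !rmorph_nat.
move: (permv _ _) (permv _ _) => v w.
rewrite !(hermformDr hn, hermformNr hn) (hermformZr hn) n2_frob n2_tvec.
rewrite !Re_add !Re_opp !Re_add Re_realM; exact: aux.
Qed.
End Cost.

(** * The duality bound *)

Section Duality.
Context {R : realType}.
Local Notation C := R[i].
Local Notation n2 := (qf (@frob _ _ _)).

Lemma rtrDl n (A B T : 'M[C]_n) : rtr (A + B) T = rtr A T + rtr B T.
Proof. by rewrite /rtr mulmxDl mxtraceD Re_add. Qed.

Lemma rtrNl n (A T : 'M[C]_n) : rtr (- A) T = - rtr A T.
Proof. by rewrite /rtr mulNmx raddfN /= Re_opp. Qed.

Lemma rtrZl n (r : R) (A T : 'M[C]_n) : rtr (r%:C%C *: A) T = r * rtr A T.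
Proof. by rewrite /rtr -scalemxAl mxtraceZ Re_realM. Qed.

Lemma rtr_scalar n (r : R) (T : 'M[C]_n) : \tr T = 1 -> rtr (r%:C%C)%:M T = r.
Proof. by move=> trT; rewrite /rtr mul_scalar_mx mxtraceZ trT mulr1. Qed.

(** In an eigenbasis of [T] the trace is the sum of the values of the form of [L], weighted by the
    nonnegative eigenvalues. *)
Lemma rtr_psd_ge0 n (L T : 'M[C]_n) : T \is hermsymmx -> psdmx T ->
  (forall v : 'cV[C]_n, 0 <= complex.Re (frob v (L *m v))) -> 0 <= rtr L T.
Proof.
move=> hT psd hL.
have /hermitian_normalmx/orthomx_spectral_subproof [[P sp] /= hP TE] := hT.
have Pinv : invmx P = P^t* := invmx_unitary hP.
have entry (A : 'M[C]_n) k :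
    frob (col k (P^t*)) (A *m col k (P^t*)) = (P *m A *m P^t*) k k.
  have -> : A *m col k (P^t*) = col k (A *m P^t*) by rewrite !colE mulmxA.
  rewrite /frob /mxtrace big_ord1 -mulmxA [LHS]mxE [RHS]mxE.
  by apply: eq_bigr => i _; rewrite ![col _ _ _ _]mxE !mxE conjCK.
have sp_ge0 k : 0 <= sp 0 k.
  have := psd (col k (P^t*)).
  have -> (v : 'cV[C]_n) : (adjmx v *m T *m v) 0 0 = frob v (T *m v).
    by rewrite /frob /mxtrace big_ord1 mulmxA.
  rewrite entry TE Pinv !mulmxA (unitarymxP hP) mul1mx -mulmxA (unitarymxP hP).
  by rewrite mulmx1 mxE eqxx mulr1n.
rewrite /rtr TE Pinv mulmxA mxtrace_mulC !mulmxA /mxtrace Re_sum.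
apply: sumr_ge0 => k _; rewrite mul_mx_diag mxE -entry mulrC.
have /andP[/eqP im0 re0] : (complex.Im (sp 0 k) == 0) && (0 <= complex.Re (sp 0 k)).
  by have := sp_ge0 k; rewrite lecE.
have -> : sp 0 k = (complex.Re (sp 0 k))%:C%C.
  by apply/eqP; rewrite eq_complex /= im0 !eqxx.
by rewrite Re_realM mulr_ge0.
Qed.

Lemma rtr_ptrace2 m n (H : 'M[C]_m) (T : 'M[C]_(m * n)) :
  rtr H (ptrace2 T) = rtr (H *t (1%:M : 'M[C]_n)) T.
Proof.
congr complex.Re; rewrite /mxtrace sum_mxtens; apply: eq_bigr => i _.
rewrite mxE; under [RHS]eq_bigr do rewrite mxE sum_mxtens.
rewrite [RHS]exchange_big; apply: eq_bigr => j _ /=.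
rewrite mxE mulr_sumr; apply: eq_bigr => k _.
rewrite (bigD1 k) //= big1 => [|l lk]; rewrite tensmxE mxE.
  by rewrite eqxx mulr1 addr0.
by rewrite eq_sym (negPf lk) mulr0 mul0r.
Qed.

Lemma rtr_ptrace1 m n (H : 'M[C]_n) (T : 'M[C]_(m * n)) :
  rtr H (ptrace1 T) = rtr ((1%:M : 'M[C]_m) *t H) T.
Proof.
congr complex.Re; rewrite /mxtrace sum_mxtens exchange_big; apply: eq_bigr => i _ /=.
rewrite mxE; under [RHS]eq_bigr do rewrite mxE sum_mxtens exchange_big.
rewrite [RHS]exchange_big; apply: eq_bigr => j _ /=.
rewrite mxE mulr_sumr; apply: eq_bigr => k _.
rewrite (bigD1 k) //= big1 => [|l lk]; rewrite tensmxE mxE.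
  by rewrite eqxx mul1r addr0.
by rewrite eq_sym (negPf lk) !mul0r.
Qed.

Lemma frob_cols m n (M N : 'M[C]_(m, n)) :
  frob M N = \sum_l frob (col l M) (col l N).
Proof.
rewrite frobE exchange_big; apply: eq_bigr => l _; rewrite frobE.
by apply: eq_bigr => i _; rewrite big_ord1 !mxE.
Qed.

Lemma frob_tr m n (M N : 'M[C]_(m, n)) : frob M^T N^T = frob M N.
Proof.
rewrite !frobE exchange_big; apply: eq_bigr => i _; apply: eq_bigr => j _.
by rewrite !mxE.
Qed.

Lemma frob_mul_cols N (H P : 'M[C]_N) :
  complex.Re (frob P (H *m P)) = \sum_l qf (opform H) (col l P).
Proof.
rewrite frob_cols Re_sum; apply: eq_bigr => l _.
by rewrite /qf /opform !colE mulmxA.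
Qed.

(** [H] on the second copy sends [P] to [P *m H^T], which after transposition is [H *m P^T]. *)
Lemma commutator_form N (H P : 'M[C]_N) :
  complex.Re (frob (tvec P) ((H *t 1%:M - 1%:M *t H) *m tvec P)) =
  \sum_l qf (opform H) (col l P) - \sum_l qf (opform H) (col l P^T).
Proof.
have hn := @hermform_frob R (N * N) 1; rewrite -!frob_mul_cols mulmxBl (hermformDr hn) (hermformNr hn) Re_add Re_opp !tensmx_tvec.
rewrite !frob_tvec trmx1 mulmx1 mul1mx.
by rewrite -(frob_tr P (P *m _)) trmx_mul trmxK.
Qed.

Lemma coupling_gap m n (FA : 'I_(m ^ 2 - 1) -> 'M[C]_m)
    (FB : 'I_(n ^ 2 - 1) -> 'M[C]_n) (H rho sigma : 'M[C]_(m * n)) tau :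
    (0 < m)%N -> (0 < n)%N -> traceless_onb FA -> traceless_onb FB ->
    H \is hermsymmx -> (lipnorm H <= 1)%E -> couplings rho sigma tau ->
    0 < rtr H rho - rtr H sigma ->
  (rtr H rho - rtr H sigma) ^+ 2 <= rtr (cost FA FB) tau.
Proof.
move=> m0 n0 hA hB hH hL [[htau psd tr1] <- <-].
rewrite rtr_ptrace2 rtr_ptrace1 -rtrNl -rtrDl.
set G := H *t _ - _; set x := rtr G tau => x0.
have [s sp gs] := lipnorm_spread m0 n0 hH hL.
have hn := @hermform_frob R (m * n * (m * n)) 1.
(* Traced against [tau], of trace 1 and with [rtr G tau = x], this reads
   [rtr (cost FA FB) tau + x^2 - 2 x^2 >= 0]. *)
suff form (v : 'cV[C]_(m * n * (m * n))) : 0 <= complex.Re (frob v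
    ((cost FA FB + ((x ^+ 2)%:C%C)%:M - (2 * x)%:C%C *: G) *m v)).
  have := rtr_psd_ge0 htau psd form; rewrite !rtrDl rtrNl rtrZl rtr_scalar // -/x.
  by clear; move: (rtr _ _) => c; lra.
have [P ->] := tvec_onto v.
have cP := cost_ge m0 n0 hA hB P.
have gP := spread_two_copies P (hermform_op hH) sp gs.
rewrite -commutator_form -/G in gP.
rewrite mulmxBl mulmxDl -scalemxAl mul_scalar_mx !(hermformDr hn, hermformNr hn).
rewrite !(hermformZr hn) n2_frob n2_tvec !Re_add Re_opp !Re_realM.
have [P0|P0] := eqVneq (n2 P) 0.
  rewrite (n2_eq0 P0) raddf0 !mulmx0 (qf0 (hermform_frob _ _)).
  by rewrite !(hermform0r hn) /= !mulr0 subr0 addr0.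
have Pp : 0 < n2 P by rewrite lt_neqAle eq_sym P0 n2_ge0.
rewrite -(pmulr_rge0 _ Pp).
move: cP gP; move: (complex.Re _) (complex.Re _) (complex.Re _) (n2 P) Pp => g c f N Np.
clear -Np => cP /le_trans/(_ (ler_wpM2l (ltW Np) cP)) gc.
(* Since [g^2 <= N c], the expression multiplied by [N] is at least [(g - x N)^2]. *)
rewrite -[complex.Re N%:C%C]/N; have := sqr_ge0 (g - x * N); nra.
Qed.
End Duality.

Theorem theorem8 (R : realType) (dA dB : nat)
  (FA : 'I_(dA ^ 2 - 1) -> 'M[R[i]]_dA) (FB : 'I_(dB ^ 2 - 1) -> 'M[R[i]]_dB)
  (hFA : traceless_onb FA) (hFB : traceless_onb FB)
  (rho : 'M[R[i]]_(dA * dB)) (hrho : density_op rho) :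
  (ereal_sup [set (rtr H rho)%:E -
                  ereal_sup [set (rtr H sigma)%:E | sigma in separable_states]
             | H in [set H : 'M[R[i]]_(dA * dB) |
                      H \is hermsymmx /\ lipnorm H <= 1]]
   <= wasserstein_ent FA FB rho)%E.
Proof.
(* In dimension 0 no matrix has trace 1. *)
have dim0 : (0 < dA * dB)%N.
  rewrite lt0n; apply/eqP => d0; have [_ _] := hrho.
  rewrite /mxtrace big1 => [/eqP|[k lt_k] _]; first by rewrite eq_sym oner_eq0.
  by exfalso; rewrite d0 in lt_k.
have /andP[A0 B0] : (0 < dA)%N && (0 < dB)%N by rewrite -muln_gt0.
apply: ge_ereal_sup => _ [H [hH hL] <-].
apply: le_ereal_inf_tmp => _ [sigma sep <-].
apply: (@le_trans _ _ ((rtr H rho)%:E - (rtr H sigma)%:E)%E).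
  by apply: leeB => //; apply: ereal_sup_ubound; exists sigma.
rewrite -EFinB /wasserstein1.
(* A nonpositive difference is below any square root; a positive one is the root of its square. *)
have [le0|gt0] := leP (rtr H rho - rtr H sigma) 0.
  by apply: le_trans (sqrte_ge0 _); rewrite lee_fin.
have -> : (rtr H rho - rtr H sigma)%:E =
    sqrte ((rtr H rho - rtr H sigma) ^+ 2)%:E.
  by rewrite /sqrte sqrtr_sqr gtr0_norm.
have gap tau : couplings rho sigma tau ->
    (rtr H rho - rtr H sigma) ^+ 2 <= rtr (cost FA FB) tau.
  by move=> htau; exact: (coupling_gap A0 B0 hFA hFB hH hL htau gt0).
(* Both the comparison of the radicands and the nonnegativity of the infimum are checked coupling by
   coupling. *)
rewrite lee_sqrt; apply: le_ereal_inf_tmp => _ [tau htau <-]; rewrite lee_fin.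
  exact: gap.
exact: le_trans (sqr_ge0 _) (gap _ htau).
Qed.
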